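(* Let $m$ be a positive integer. Then the region unknotting number of the $2$-bridge knot/link $C(m,2,m)$ is $1$; the region unknotting number of the $2$-bridge knot/link $C(m,2,m+1)$ is $1$; and, if $m\ge 2$, the region unknotting number of the $2$-bridge knot/link $C(m,2,m-1)$ is $1$.
   Context: For positive integers $c_1,\dots,c_k$, $C(c_1,\dots,c_k)$ denotes the $2$-bridge knot or link in Conway normal form: its standard alternating diagram is built from integer twist regions with $c_1,c_2,\dots,c_k$ crossings, alternately horizontal and vertical. Up to mirror image it is the $2$-bridge knot/link with fraction $c_1+\frac{1}{c_2+\frac{1}{\ddots+\frac{1}{c_k}}}$. A region crossing change at a region $R$ of a diagram $D$ on $S^2$ changes every crossing lying on $\partial R$. $u_R(D)$ is the minimum number of region crossing changes needed to transform $D$ (without Reidemeister moves) into a diagram of the trivial knot (of the trivial link, if $D$ is a diagram of a link). The region unknotting number $u_R(K)$ is the minimum of $u_R(D)$ over all minimal crossing diagrams $D$ of $K$. *)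

(* Defs.v *)
From mathcomp Require Import all_boot.
From Stdlib Require Import Relations.

Set Implicit Arguments.
Unset Strict Implicit.
Unset Printing Implicit Defensive.

(* An unoriented link diagram is put in general position with respect to a
   height function on the plane and read from bottom to top as a word of
   elementary tangles, each containing one minimum, one maximum or one
   crossing.  Every link diagram on the sphere is isotopic to one of this form:
   choose a point at infinity, then perturb.  Disconnected diagrams and
   components without crossings are included. *)

(* In [Cross s] the strand that runs from bottom left to top right is the
   over-strand iff [s]. *)
Inductive tangle := Cup | Cap | Cross of bool.

Definition ar_in (k : tangle) : nat := if k is Cup then 0 else 2.
Definition ar_out (k : tangle) : nat := if k is Cap then 0 else 2.

(* [(k, i)] is [k] with [i] vertical strands on its left. *)
Definition letter := (tangle * nat)%type.

(* The number of strands above [w] when there are [n] below it; [None] if [w]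
   cannot be stacked on [n] strands. *)
Fixpoint strands (n : nat) (w : seq letter) : option nat :=
  if w is (k, i) :: w' then
    if i + ar_in k <= n then strands (n - ar_in k + ar_out k) w' else None
  else Some n.

Definition closed (w : seq letter) : bool := strands 0 w == Some 0.

Record diagram := Diagram { word :> seq letter; wordP : closed word }.

Definition is_cross (l : letter) : bool := if l.1 is Cross _ then true else false.

Definition crossings (D : diagram) : nat := count is_cross D.

(* The first five moves generate isotopy of plane diagrams; together with the
   Reidemeister moves they generate ambient isotopy of links (Freyd-Yetter,
   Turaev).  The other variants of the Reidemeister moves follow from these. *)
Inductive move : seq letter -> seq letter -> Prop :=
| Exchange k l i d :
    move [:: (k, i); (l, i + ar_out k + d)] [:: (l, i + ar_in k + d); (k, i)]
| ZigzagL i : move [:: (Cup, i); (Cap, i.+1)] [::]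
| ZigzagR i : move [:: (Cup, i.+1); (Cap, i)] [::]
| SwingCap s i :
    move [:: (Cross s, i); (Cap, i.+1)] [:: (Cross (~~ s), i.+1); (Cap, i)]
| SwingCup s i :
    move [:: (Cup, i); (Cross s, i.+1)] [:: (Cup, i.+1); (Cross (~~ s), i)]
| Reidemeister1Cap s i : move [:: (Cross s, i); (Cap, i)] [:: (Cap, i)]
| Reidemeister1Cup s i : move [:: (Cup, i); (Cross s, i)] [:: (Cup, i)]
| Reidemeister2 s i : move [:: (Cross s, i); (Cross (~~ s), i)] [::]
| Reidemeister3 s i :
    move [:: (Cross s, i); (Cross s, i.+1); (Cross s, i)]
         [:: (Cross s, i.+1); (Cross s, i); (Cross s, i.+1)].

Definition move_step (D D' : diagram) : Prop :=
  exists u v a b : seq letter,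
    [/\ move a b, word D = u ++ a ++ v & word D' = u ++ b ++ v].

(* [D] and [D'] are diagrams of the same link. *)
Definition link_equiv : diagram -> diagram -> Prop :=
  clos_refl_sym_trans diagram move_step.

Definition unlink_word (k : nat) : seq letter :=
  flatten (nseq k [:: (Cup, 0); (Cap, 0)]).

Lemma unlink_closed k : closed (unlink_word k).
Proof. by elim: k. Qed.

Definition unlink (k : nat) : diagram := Diagram (unlink_closed k).

(* The number of components is invariant under [link_equiv] and under crossing
   changes, so for a knot diagram this says that the knot is trivial. *)
Definition trivial_diagram (D : diagram) : Prop :=
  exists k : nat, link_equiv D (unlink k).

Definition letter_at (D : diagram) (t : nat) : letter := nth (Cup, 0) D t.

Definition width (D : diagram) (t : nat) : nat :=
  odflt 0 (strands 0 (take t D)).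

(* A gap is a component of the complement of the diagram in one of the
   horizontal lines that separate the letters: at level [t], just below the
   [t]-th letter, gap [g] has [g] strands on its left. *)
Definition gap (D : diagram) : finType :=
  {t : 'I_(size D).+1 & 'I_(width D t).+1}.

Definition level (D : diagram) (x : gap D) : nat := tag x.
Definition offset (D : diagram) (x : gap D) : nat := tagged x.

(* The gaps below and above a letter that meet on its left or on its right. *)
Definition gap_above (D : diagram) (x y : gap D) : bool :=
  let: (k, i) := letter_at D (level x) in
  (level y == (level x).+1) &&
  ((offset x <= i) && (offset y == offset x)
   || (i + ar_in k <= offset x)
      && (offset y + ar_in k == offset x + ar_out k)).

Definition gap_adj (D : diagram) : rel (gap D) :=
  [rel x y | gap_above x y || gap_above y x].

Definition regions (D : diagram) : {set {set gap D}} :=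
  [set [set y | connect (@gap_adj D) x y] | x : gap D].

(* The crossing at height [t] lies on the boundary of [R]. *)
Definition on_boundary (D : diagram) (R : {set gap D}) (t : nat) : bool :=
  is_cross (letter_at D t) &&
  [exists x in R, (t <= level x <= t.+1) &&
     ((letter_at D t).2 <= offset x <= (letter_at D t).2 + 2)].

Definition switch (l : letter) : letter :=
  if l is (Cross s, i) then (Cross (~~ s), i) else l.

Definition region_change_word (D : diagram) (R : {set gap D}) : seq letter :=
  mkseq (fun t => if on_boundary R t then switch (letter_at D t)
                  else letter_at D t) (size D).

Lemma strands_switch (P : nat -> bool) (w : seq letter) (n j : nat) :
  strands n [seq (if P (j + t) then switch (nth (Cup, 0) w t)
                  else nth (Cup, 0) w t) | t <- iota 0 (size w)]
  = strands n w.
Proof.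
elim: w n j => //= -[k i] w IH n j; rewrite -(addn0 1) iotaDl -map_comp addn0.
under eq_map => t do rewrite /= add1n -addSnnS /=.
by case: (P j); case: k => [||s] /=; rewrite !IH.
Qed.

Lemma region_change_closed (D : diagram) (R : {set gap D}) :
  closed (region_change_word R).
Proof.
rewrite /closed (_ : strands 0 _ = strands 0 D); first exact: wordP.
exact: (strands_switch (on_boundary R) D 0 0).
Qed.

Definition region_change (D : diagram) (R : {set gap D}) : diagram :=
  Diagram (region_change_closed R).

Inductive region_changes : nat -> diagram -> diagram -> Prop :=
| Changes0 D : region_changes 0 D D
| ChangesS n D D' (R : {set gap D}) :
    R \in regions D -> region_changes n (region_change R) D' ->
    region_changes n.+1 D D'.

Definition is_min (P : nat -> Prop) (n : nat) : Prop :=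
  P n /\ forall k, P k -> n <= k.

(* The value n of u_R(D).  For some links there is none. *)
Definition diagram_region_unknotting_number (D : diagram) : nat -> Prop :=
  is_min (fun n =>
    exists D', region_changes n D D' /\ trivial_diagram D').

Definition minimal_crossing_diagram (K D : diagram) : Prop :=
  link_equiv D K /\ forall D', link_equiv D' K -> crossings D <= crossings D'.

(* The value n of u_R(K) for the link with diagram [K]. *)
Definition region_unknotting_number (K : diagram) : nat -> Prop :=
  is_min (fun n => exists D,
    minimal_crossing_diagram K D /\ diagram_region_unknotting_number D n).

(* C(c_1, ..., c_k) is the link of fraction c_1 + 1/(c_2 + 1/(... + 1/c_k)) up to
   mirror image, which does not affect region unknotting numbers.  Its twist
   regions are drawn as crossings in a braid with four strands, alternately
   between the middle strands ([b = true]) and between the first two.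
   The signs alternate, which makes the diagram alternating. *)
Fixpoint conway_twists (b : bool) (cs : seq nat) : seq letter :=
  if cs is c :: cs' then
    nseq c (Cross b, nat_of_bool b) ++ conway_twists (~~ b) cs'
  else [::].

(* The top is closed like the bottom, joining strands 1-2 and 3-4, if the last
   twist region is between the middle strands, and joining 2-3 and 1-4 if not. *)
Definition conway_word (cs : seq nat) : seq letter :=
  [:: (Cup, 0); (Cup, 2)] ++ conway_twists true cs
  ++ (if odd (size cs) then [:: (Cap, 0); (Cap, 0)]
      else [:: (Cap, 1); (Cap, 0)]).

Lemma strands_conway_twists b cs w :
  strands 4 (conway_twists b cs ++ w) = strands 4 w.
Proof.
elim: cs b => //= c cs IH b; rewrite -catA -(IH (~~ b)).
by elim: c => //= c ->; case: b.
Qed.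

Lemma conway_closed cs : closed (conway_word cs).
Proof.
by rewrite /closed /conway_word /= strands_conway_twists; case: (odd _).
Qed.

Definition conway (cs : seq nat) : diagram := Diagram (conway_closed cs).

(* Main.v *)
Require Import Defs.
From mathcomp Require Import all_boot all_order all_algebra all_fingroup.
From mathcomp Require Import zify ring.
From Stdlib Require Import Relations.

Set Implicit Arguments.
Unset Strict Implicit.
Unset Printing Implicit Defensive.
Import GRing.Theory Num.Theory.

(** The upper bound is a picture.  In the standard diagram of C(m, 2, n), the region
    between the two strands of the first cup touches all [m] crossings of the first
    twist region and one of the two middle crossings.  After the change of this
    region the middle crossings cancel, the first and last twist regions merge with
    opposite signs, and when m and n differ by at most one, at most one crossing is
    left, which is a curl ([two_twists_trivial]).

    It remains to see that the standard diagram has the least number of crossings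
    among all diagrams of the link ([conway_minimal]); this also shows that the link
    is not trivial.  The argument is that of Kauffman, Murasugi and Thistlethwaite.
    The Kauffman bracket is a sum over the states of the diagram, and its span is
    unchanged by the Reidemeister moves.  For a connected diagram with [c] crossings
    the span is at most [4 * c], up to normalization, because complementary states
    have at most [c + 2] loops together; for the standard diagram, it is [4 * c].

    Loops are counted by labelings of the strands with bits: [k] loops have [2 ^ k]
    labelings.  Such numbers can be computed letter by letter, satisfy the relations
    of plane isotopy by a local check, and turn the bound on loops into linear
    algebra over the field with two elements ([loops_pair]).  There, labelings of two
    states add up to elements of the cycle space of the diagram, seen as a graph
    whose vertices are the crossings.  The size of the cycle space is found by a
    Fourier transform, which takes it to the labelings that are constant on the
    components of the diagram ([nlab_parity]).

    Instead of Laurent polynomials in a variable [A], the bracket is evaluated at two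
    points.  Its product with the bracket of the mirror image, [bracket_norm], is
    invariant under all moves.  At [A = 2] the power of two in the denominator of
    this rational number plays the role of the span ([norm_integral],
    [conway_norm_odd]).  A diagram with several components satisfies only a weaker
    bound; it is excluded by the nonzero determinant of the link, through an
    evaluation at an integer modulo the cube of another one ([conway_connected]). *)

(** * Bit vectors *)

Fixpoint bits (n : nat) : seq (seq bool) :=
  if n is n'.+1 then
    [seq false :: x | x <- bits n'] ++ [seq true :: x | x <- bits n']
  else [:: [::]].

Lemma mem_bits n x : (x \in bits n) = (size x == n).
Proof.
elim: n x => [|n IH] [|b x] //=; rewrite mem_cat.
  by apply/negbTE/norP; split; apply/mapP => -[].
rewrite eqSS -IH; apply/orP/idP => [[] /mapP[y Hy [_ ->]] //| Hx].
by case: b; [right|left]; apply/mapP; exists x.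
Qed.

Lemma size_bits n x : x \in bits n -> size x = n.
Proof. by rewrite mem_bits => /eqP. Qed.

Lemma bits_uniq n : uniq (bits n).
Proof.
elim: n => //= n IH; rewrite cat_uniq !map_inj_uniq ?IH ?andbT /=; last 2 first.
- by move=> ? ? [].
- by move=> ? ? [].
by apply/hasP => -[_ /mapP[y _ ->]] /mapP[].
Qed.

Section BigBits.
Variables (T : Type) (idx : T) (op : Monoid.com_law idx).

Lemma big_bitsS n (F : seq bool -> T) :
  \big[op/idx]_(x <- bits n.+1) F x =
  op (\big[op/idx]_(x <- bits n) F (false :: x))
     (\big[op/idx]_(x <- bits n) F (true :: x)).
Proof. by rewrite /= big_cat !big_map. Qed.

Lemma big_bits_cat m n (F : seq bool -> T) :
  \big[op/idx]_(x <- bits (m + n)) F x =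
  \big[op/idx]_(x <- bits m) \big[op/idx]_(y <- bits n) F (x ++ y).
Proof.
elim: m F => [|m IH] F; first by rewrite big_seq1.
by rewrite addSn !big_bitsS !IH.
Qed.

End BigBits.

(** * Labelings of smoothed diagrams *)

(** Besides the two smoothings of a crossing, [Through] and [Turn], a crossing can
    be replaced by two linear conditions on the four labels around it: their sum
    vanishes ([Parity]), or they are all equal ([Fused]).  Labelings of the
    [Fused] diagram are constant on its connected components, so there are
    [2 ^ k] of them when it has [k] components; [Parity] is the dual condition. *)
Inductive kind := Through | Turn | Parity | Fused.
Inductive piece := Min | Max | Joint of kind.

Definition p_in (p : piece) : nat := if p is Min then 0 else 2.
Definition p_out (p : piece) : nat := if p is Max then 0 else 2.

Definition kfits (k : kind) (a b c d : bool) : bool :=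
  match k with
  | Through => (a == c) && (b == d)
  | Turn => (a == b) && (c == d)
  | Parity => ~~ (a (+) b (+) c (+) d)
  | Fused => [&& a == b, a == c & a == d]
  end.

Definition fits (p : piece) (x y : seq bool) : bool :=
  match p with
  | Min => nth false y 0 == nth false y 1
  | Max => nth false x 0 == nth false x 1
  | Joint k => kfits k (nth false x 0) (nth false x 1)
                       (nth false y 0) (nth false y 1)
  end.

Definition pword := seq (piece * nat).

Fixpoint pstrands (n : nat) (w : pword) : option nat :=
  if w is (p, i) :: w' then
    if i + p_in p <= n then pstrands (n - p_in p + p_out p) w' else None
  else Some n.

Definition window (i a : nat) (x : seq bool) := take a (drop i x).
Definition splice (i a : nat) (o x : seq bool) :=
  take i x ++ o ++ drop (i + a) x.

(** The number of ways to label the arcs above a line by bits, given the labels [x]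
    of the strands that cross the line.  For a union of [k] disjoint loops it is
    [2 ^ k], and it can be computed one letter at a time, without following the
    loops around. *)
Fixpoint nlab (w : pword) (x : seq bool) : nat :=
  if w is (p, i) :: w' then
    \sum_(o <- bits (p_out p))
      fits p (window i (p_in p) x) o * nlab w' (splice i (p_in p) o x)
  else 1.

Lemma window_cat pre m suf : window (size pre) (size m) (pre ++ m ++ suf) = m.
Proof. by rewrite /window drop_size_cat // take_size_cat. Qed.

Lemma splice_cat pre m suf o :
  splice (size pre) (size m) o (pre ++ m ++ suf) = pre ++ o ++ suf.
Proof.
by rewrite /splice take_size_cat // -size_cat [pre ++ m ++ suf]catA drop_size_cat.
Qed.

Lemma nlabE p i w pre m suf : size pre = i -> size m = p_in p ->
  nlab ((p, i) :: w) (pre ++ m ++ suf) =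
  \sum_(o <- bits (p_out p)) fits p m o * nlab w (pre ++ o ++ suf).
Proof.
move=> <- Hm /=; apply: eq_bigr => o _; rewrite -Hm.
by rewrite window_cat splice_cat.
Qed.

Lemma size_splice i a o x : i + a <= size x ->
  size (splice i a o x) = size x - a + size o.
Proof.
by move=> H; rewrite /splice !size_cat size_drop size_takel; lia.
Qed.

Lemma split_at i a (x : seq bool) : i + a <= size x ->
  exists pre m suf, [/\ x = pre ++ m ++ suf, size pre = i & size m = a].
Proof.
move=> H; exists (take i x), (take a (drop i x)), (drop a (drop i x)).
by rewrite !cat_take_drop !size_takel ?size_drop //; lia.
Qed.

(** A relation between the numbers of labelings of two tangles survives whatever is
    put below them. *)
Lemma nlab_cat c u a b n m x :
    pstrands n u = Some m -> size x = n ->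
    (forall y, size y = m -> nlab a y = c * nlab b y) ->
  nlab (u ++ a) x = c * nlab (u ++ b) x.
Proof.
move=> + + H; elim: u n x => [|[p i] u IH] n x /=.
  by move=> [Hm] Hx; apply: H; rewrite Hx.
case: ifP => // Hi Hu Hx; rewrite big_distrr /= big_seq [RHS]big_seq.
apply: eq_bigr => o Ho.
rewrite (IH _ (splice i (p_in p) o x) Hu) 1?mulnCA //.
by rewrite size_splice ?Hx // (size_bits Ho).
Qed.

Lemma nlab_through i v x : i + 2 <= size x ->
  nlab ((Joint Through, i) :: v) x = nlab v x.
Proof.
case/split_at=> pre [m [suf [-> Hp]]]; case: m => [|a [|b [|]]] // _.
rewrite nlabE // !big_bitsS !big_seq1.
by case: a b => [] []; rewrite /= ?mul0n ?mul1n ?add0n ?addn0.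
Qed.

Lemma nlab_turn i v x : i + 2 <= size x ->
  nlab ((Joint Turn, i) :: v) x = nlab ((Max, i) :: (Min, i) :: v) x.
Proof.
case/split_at=> pre [m [suf [-> Hp]]]; case: m => [|a [|b [|]]] // _.
rewrite 2?nlabE // big_seq1 (@nlabE Min i v pre [::] suf) // !big_bitsS !big_seq1.
by case: a b => [] []; rewrite /= ?mul0n ?mul1n ?add0n ?addn0.
Qed.

Lemma nlab_loop i v x : i <= size x ->
  nlab ((Min, i) :: (Max, i) :: v) x = 2 * nlab v x.
Proof.
rewrite -{1}(addn0 i); case/split_at=> pre [m [suf [-> Hp]]]; case: m => [|] // _.
rewrite nlabE // !big_bitsS !big_seq1 !nlabE // !big_seq1 /=; lia.
Qed.

Lemma nlab_zigzagL i v x : i.+1 <= size x ->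
  nlab ((Min, i) :: (Max, i.+1) :: v) x = nlab v x.
Proof.
rewrite -addn1; case/split_at=> pre [m [suf [-> Hp]]]; case: m => [|a [|]] // _.
rewrite (@nlabE Min i _ pre [::] (a :: suf)) //.
rewrite !big_bitsS !big_seq1.
have E b c : pre ++ [:: b; c] ++ a :: suf = rcons pre b ++ [:: c; a] ++ suf.
  by rewrite cat_rcons.
rewrite !E !nlabE ?size_rcons ?Hp ?addn1 // !big_seq1 /= !cat_rcons.
by clear E; case: a; rewrite /= ?mul0n ?mul1n ?add0n ?addn0.
Qed.

Lemma nlab_zigzagR i v x : i.+1 <= size x ->
  nlab ((Min, i.+1) :: (Max, i) :: v) x = nlab v x.
Proof.
rewrite -addn1; case/split_at=> pre [m [suf [-> Hp]]]; case: m => [|a [|]] // _.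
rewrite catA (@nlabE Min _ _ (pre ++ [:: a]) [::] suf) //; last first.
  by rewrite size_cat Hp.
rewrite !big_bitsS !big_seq1.
have E b c : (pre ++ [:: a]) ++ [:: b; c] ++ suf = pre ++ [:: a; b] ++ c :: suf.
  by rewrite -!catA.
rewrite !E !nlabE ?Hp // !big_seq1 /= -!catA /=.
by clear E; case: a; rewrite /= ?mul0n ?mul1n ?add0n ?addn0.
Qed.

Lemma nlab_exchange p q i d v x : i + p_in p + d + p_in q <= size x ->
  nlab [:: (p, i), (q, i + p_out p + d) & v] x =
  nlab [:: (q, i + p_in p + d), (p, i) & v] x.
Proof.
move=> Hx.
have [pre [m [suf [Ex Hp Hm]]]] : exists pre m suf,
    [/\ x = pre ++ m ++ suf, size pre = i & size m = p_in p].
  by apply: split_at; apply: leq_trans Hx; lia.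
have [mid [m' [suf' [Es Hp' Hm']]]] : exists pre m' suf',
    [/\ suf = pre ++ m' ++ suf', size pre = d & size m' = p_in q].
  by apply: split_at; move: Hx; rewrite Ex !size_cat Hp Hm; lia.
rewrite {}Ex {}Es {Hx} nlabE //.
transitivity (\sum_(o <- bits (p_out p)) \sum_(o' <- bits (p_out q))
   fits p m o * (fits q m' o' * nlab v (pre ++ o ++ mid ++ o' ++ suf'))).
  rewrite big_seq [RHS]big_seq; apply: eq_bigr => o Ho; rewrite -big_distrr.
  congr (_ * _).
  have -> : pre ++ o ++ mid ++ m' ++ suf' = (pre ++ o ++ mid) ++ m' ++ suf'.
    by rewrite -!catA.
  rewrite nlabE //; last by rewrite !size_cat Hp Hp' (size_bits Ho) addnA.
  by apply: eq_bigr => o' _; rewrite -!catA.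
rewrite exchange_big.
have -> : pre ++ m ++ mid ++ m' ++ suf' = (pre ++ m ++ mid) ++ m' ++ suf'.
  by rewrite -!catA.
rewrite nlabE //; last by rewrite !size_cat Hp Hm Hp' addnA.
apply: eq_bigr => o' _; rewrite -!catA nlabE // big_distrr /=.
by apply: eq_bigr => o _; rewrite mulnCA.
Qed.

(** * Linear structure of labelings *)

Definition xor (x y : seq bool) : seq bool :=
  [seq p.1 (+) p.2 | p <- zip x y].

Lemma nth_xor x y i : size x = size y ->
  nth false (xor x y) i = nth false x i (+) nth false y i.
Proof.
by elim: x y i => [|a x IH] [|b y] [|i] //= [H]; rewrite IH.
Qed.

Lemma take_xor n x y : take n (xor x y) = xor (take n x) (take n y).
Proof.
elim: x y n => [|a x IH] [|b y] [|n] //.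
by rewrite [LHS]/= [X in xor X]/= [X in xor _ X]/= [RHS]/=; congr cons; apply: IH.
Qed.

Lemma drop_xor n x y : drop n (xor x y) = xor (drop n x) (drop n y).
Proof.
elim: x y n => [|a x IH] [|b y] [|n] //; last exact: IH.
  by rewrite /= /xor; case: (drop _ _).
by rewrite /= /xor; case: (drop _ _).
Qed.

Lemma cat_xor x y x' y' : size x = size y ->
  xor x y ++ xor x' y' = xor (x ++ x') (y ++ y').
Proof. by move=> H; rewrite /xor zip_cat // map_cat. Qed.

Fixpoint nbits (w : pword) : nat :=
  if w is (p, _) :: w' then p_out p + nbits w' else 0.

(** [b] lists the labels that the letters of [w] produce, from bottom to top; these
    determine the whole labeling, because labels change only at letters. *)
Fixpoint valid (w : pword) (x b : seq bool) : bool :=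
  if w is (p, i) :: w' then
    fits p (window i (p_in p) x) (take (p_out p) b)
    && valid w' (splice i (p_in p) (take (p_out p) b) x) (drop (p_out p) b)
  else true.

Lemma nlab_valid w x : nlab w x = \sum_(b <- bits (nbits w)) valid w x b.
Proof.
elim: w x => [|[p i] w IH] x /=; first by rewrite big_seq1.
rewrite big_bits_cat big_seq [RHS]big_seq; apply: eq_bigr => o Ho.
rewrite IH big_distrr /=; apply: eq_bigr => b _.
have Hs := size_bits Ho.
by rewrite take_size_cat // drop_size_cat // mulnb.
Qed.

(** Labelings of a diagram form a vector space over the field with two elements.
    The three-term form also covers the sum of labelings of two different
    smoothings, which is a labeling of the [Parity] diagram. *)
Definition kind_sum (k l m : kind) : Prop :=
  forall a b c d a' b' c' d', kfits k a b c d -> kfits l a' b' c' d' ->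
  kfits m (a (+) a') (b (+) b') (c (+) c') (d (+) d').

Definition piece_sum (p q r : piece) : Prop :=
  match p, q, r with
  | Min, Min, Min | Max, Max, Max => True
  | Joint k, Joint l, Joint m => kind_sum k l m
  | _, _, _ => False
  end.

Fixpoint word_sum (u v w : pword) : Prop :=
  match u, v, w with
  | [::], [::], [::] => True
  | (p, i) :: u', (q, j) :: v', (r, k) :: w' =>
      [/\ j = i, k = i, piece_sum p q r & word_sum u' v' w']
  | _, _, _ => False
  end.

Lemma kind_sumxx k : kind_sum k k k.
Proof. by case: k => [] [] [] [] [] [] [] [] []. Qed.

Lemma word_sumxx w : word_sum w w w.
Proof. by elim: w => //= -[[||k] i] w IH; split=> //=; exact: kind_sumxx. Qed.

Lemma piece_sum_in p q r : piece_sum p q r -> p_in q = p_in p /\ p_in r = p_in p.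
Proof. by case: p q r => [||k] [||l] [||m]. Qed.

Lemma piece_sum_out p q r : piece_sum p q r -> p_out q = p_out p /\ p_out r = p_out p.
Proof. by case: p q r => [||k] [||l] [||m]. Qed.

Lemma fits_add p q r x y o o' : piece_sum p q r ->
    size x = size y -> size o = size o' -> fits p x o -> fits q y o' ->
  fits r (xor x y) (xor o o').
Proof.
move=> H Hx Ho; case: p q r H => [||k] [||l] [||m] //= H; rewrite !nth_xor //.
- by move=> /eqP-> /eqP->.
- by move=> /eqP-> /eqP->.
exact: H.
Qed.

Lemma size_window i a x y : size x = size y ->
  size (window i a x) = size (window i a y).
Proof. by move=> H; rewrite /window !size_take_min !size_drop H. Qed.

Lemma window_xor i a x y :
  window i a (xor x y) = xor (window i a x) (window i a y).
Proof. by rewrite /window drop_xor take_xor. Qed.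

Lemma splice_xor i a o o' x y : size x = size y -> size o = size o' ->
  splice i a (xor o o') (xor x y) = xor (splice i a o x) (splice i a o' y).
Proof.
move=> Hx Ho; rewrite /splice take_xor drop_xor !cat_xor //.
by rewrite !size_take_min Hx.
Qed.

Lemma size_splice_eq i a o o' x y : size x = size y -> size o = size o' ->
  size (splice i a o x) = size (splice i a o' y).
Proof.
by move=> Hx Ho; rewrite /splice !size_cat !size_take_min !size_drop Hx Ho.
Qed.

Lemma valid_add u v w x y b c : word_sum u v w -> size x = size y ->
    size b = size c -> valid u x b -> valid v y c ->
  valid w (xor x y) (xor b c).
Proof.
elim: u v w x y b c => [|[p i] u IH] [|[q j] v] [|[r k] w] x y b c //=.
case=> -> -> Hp Hw Hx Hb.
have [-> ->] := piece_sum_in Hp; have [-> ->] := piece_sum_out Hp.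
have Ho : size (take (p_out p) b) = size (take (p_out p) c).
  by rewrite !size_take_min Hb.
case/andP=> F1 V1 /andP[F2 V2]; rewrite window_xor !take_xor drop_xor.
rewrite (fits_add Hp) ?(size_window _ _ Hx) //= splice_xor //.
apply: (IH _ _ _ _ _ _ Hw) V1 V2; last by rewrite !size_drop Hb.
exact: size_splice_eq.
Qed.

(** [Fused] is a condition of codimension at most one inside [Through] and inside
    [Turn]: two labelings that violate it differ by one that satisfies it. *)
Lemma valid_to_fused k u i v x y b c : k <> Parity ->
    size x = size y -> size b = size c ->
    valid (u ++ (Joint k, i) :: v) x b ->
    ~~ valid (u ++ (Joint Fused, i) :: v) x b ->
    valid (u ++ (Joint k, i) :: v) y c ->
    ~~ valid (u ++ (Joint Fused, i) :: v) y c ->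
  valid (u ++ (Joint Fused, i) :: v) (xor x y) (xor b c).
Proof.
move=> Hk; elim: u x y b c => [|[p j] u IH] x y b c Hx Hb.
  have Ho : size (take 2 b) = size (take 2 c) by rewrite !size_take_min Hb.
  rewrite !cat0s /= => /andP[F1 V1]; rewrite V1 andbT => N1.
  case/andP=> F2 V2; rewrite V2 andbT => N2.
  apply/andP; split; last first.
    rewrite take_xor drop_xor splice_xor //.
    apply: (valid_add (word_sumxx v)) V1 V2; rewrite ?size_drop ?Hb //.
    exact: size_splice_eq.
  move: F1 N1 F2 N2; rewrite window_xor take_xor !nth_xor ?(size_window _ _ Hx) //.
  do 8 case: (nth _ _ _) => //=; by case: k Hk => // H; case: H.
rewrite !cat_cons /= => /andP[F1 V1]; rewrite F1 /= => N1.
case/andP=> F2 V2; rewrite F2 /= => N2.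
have Ho : size (take (p_out p) b) = size (take (p_out p) c).
  by rewrite !size_take_min Hb.
apply/andP; split.
  rewrite window_xor take_xor.
  apply: fits_add F1 F2 => //; last exact: size_window.
  by case: p {V1 V2 N1 N2 Ho} => //= l; apply: kind_sumxx.
rewrite take_xor drop_xor splice_xor //.
by apply: IH; rewrite // ?size_drop ?Hb //; apply: size_splice_eq.
Qed.

Lemma valid_zero w x b : nth false x =1 (fun=> false) ->
  nth false b =1 (fun=> false) -> valid w x b.
Proof.
elim: w x b => //= -[p i] w IH x b Hx Hb.
have Ht n z : nth false z =1 (fun=> false) ->
    nth false (take n z) =1 (fun=> false).
  move=> Hz j; have [H|H] := ltnP j n; first by rewrite nth_take.
  by rewrite nth_default // size_take_min geq_min H.
have Hd n z : nth false z =1 (fun=> false) ->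
    nth false (drop n z) =1 (fun=> false) by move=> Hz j; rewrite nth_drop Hz.
have Hc y z : nth false y =1 (fun=> false) -> nth false z =1 (fun=> false) ->
    nth false (y ++ z) =1 (fun=> false).
  by move=> Hy Hz j; rewrite nth_cat Hy Hz if_same.
apply/andP; split; last first.
  apply: IH; last exact: Hd.
  by rewrite /splice; apply: (Hc); [apply: Ht | apply: (Hc); [apply: Ht | apply: Hd]].
rewrite /window; case: p => [||k]; rewrite /fits ?(Ht _ _ (Hd _ _ Hx)) ?(Ht _ _ Hb) //.
by case: k.
Qed.

Section Labelings.
Variable N : nat.

Definition bits_of (r : 'rV[bool]_N) : seq bool := [seq r ord0 i | i : 'I_N].

Lemma size_bits_of r : size (bits_of r) = N.
Proof. by rewrite size_map size_enum_ord. Qed.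

Lemma nth_bits_of r (i : 'I_N) : nth false (bits_of r) i = r ord0 i.
Proof. by rewrite (nth_map i) ?size_enum_ord // nth_ord_enum. Qed.

Lemma bits_ofD r s : bits_of (r + s)%R = xor (bits_of r) (bits_of s).
Proof.
rewrite /xor /bits_of zip_map -map_comp; apply: eq_map => i /=.
by rewrite mxE.
Qed.

Lemma bits_of_inj : injective bits_of.
Proof.
by move=> r s H; apply/rowP=> i; rewrite -!nth_bits_of H.
Qed.

Lemma bits_of_onto b : b \in bits N -> exists r, b = bits_of r.
Proof.
rewrite mem_bits => /eqP Hb; exists (\row_i nth false b i)%R.
apply: (@eq_from_nth _ false); rewrite ?size_bits_of // Hb => i Hi.
by rewrite (nth_bits_of _ (Ordinal Hi)) mxE.
Qed.

Definition labelings (w : pword) : {set 'rV[bool]_N} :=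
  [set r | valid w [::] (bits_of r)].

Lemma card_labelings w : nbits w = N -> #|labelings w| = nlab w [::].
Proof.
move=> HN; rewrite nlab_valid HN -sum1_card.
have Hp : perm_eq [seq bits_of r | r : 'rV[bool]_N] (bits N).
  apply: uniq_perm; rewrite ?bits_uniq ?(map_inj_uniq bits_of_inj) ?enum_uniq //.
  move=> b; apply/mapP/idP => [[r _ ->]|/bits_of_onto[r ->]].
    by rewrite mem_bits size_bits_of.
  by exists r; rewrite ?mem_enum.
rewrite -(perm_big _ Hp) big_map big_enum /= big_mkcond /=.
by apply: eq_bigr => r _; rewrite inE; case: valid.
Qed.

Lemma labelings_group w : group_set (labelings w).
Proof.
apply/group_setP; split=> [|r s]; rewrite !inE.
  apply: valid_zero => i; first by rewrite nth_nil.
  have [H|H] := ltnP i N; last by rewrite nth_default // size_bits_of.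
  by rewrite (nth_bits_of _ (Ordinal H)) mxE.
move=> Hr Hs; rewrite bits_ofD; have := valid_add (word_sumxx w) _ _ Hr Hs.
by apply; rewrite ?size_bits_of.
Qed.

Canonical labelings_groupType w := Group (labelings_group w).

End Labelings.

(** For a state, in which every crossing is [Through] or [Turn], this is the number
    of its loops; for the [Fused] diagram, the number of connected components. *)
Definition loops (w : pword) : nat := trunc_log 2 (nlab w [::]).

(** The labelings form a subgroup of an elementary abelian 2-group, so Lagrange's
    theorem makes their number a power of two. *)
Lemma nlab_loops w : nlab w [::] = 2 ^ loops w.
Proof.
rewrite /loops -(@card_labelings (nbits w)) //.
have := cardSg (subsetT [group of @labelings (nbits w) w]).
rewrite cardsT card_mx card_bool mul1n => /(dvdn_pfactor _ _ (isT : prime 2)).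
by case=> k _ ->; rewrite trunc_expnK.
Qed.

(** The product formula for subgroups: the sum of the two labeling groups lies in
    the labelings of [p] and their intersection in those of [m]. *)
Lemma nlab_mul u v p m : nbits v = nbits u -> nbits p = nbits u ->
    nbits m = nbits u -> word_sum u v p ->
    (forall b, valid u [::] b -> valid v [::] b -> valid m [::] b) ->
  nlab u [::] * nlab v [::] <= nlab p [::] * nlab m [::].
Proof.
move=> Hv Hp Hm Hadd Hcap.
rewrite -!(@card_labelings (nbits u)) //.
have := mul_cardG [group of labelings (nbits u) u] [group of labelings (nbits u) v].
move=> /= ->; apply: leq_mul; apply: subset_leq_card; apply/subsetP.
  move=> _ /mulsgP[r s Hr Hs ->]; move: Hr Hs; rewrite !inE => Hr Hs.
  rewrite bits_ofD; have := valid_add Hadd _ _ Hr Hs.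
  by apply; rewrite ?size_bits_of.
by move=> r; rewrite !inE => /andP[]; apply: Hcap.
Qed.

Lemma nbits_cat u v : nbits (u ++ v) = nbits u + nbits v.
Proof. by elim: u => //= -[p i] u ->; rewrite addnA. Qed.

Lemma nlab_fuse k u i v : k <> Parity ->
  nlab (u ++ (Joint k, i) :: v) [::] <= 2 * nlab (u ++ (Joint Fused, i) :: v) [::].
Proof.
move=> Hk; set w := u ++ _; set w' := u ++ _.
have HN : nbits w' = nbits w by rewrite !nbits_cat.
rewrite -!(@card_labelings (nbits w)) //.
set G := labelings _ w; set H := labelings _ w'.
have [sGH|/subsetPn[g Gg Hg]] := boolP (G \subset H).
  by apply: leq_trans (subset_leq_card sGH) _; rewrite leq_pmull.
rewrite mul2n -addnn -{2}(card_lcoset H g).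
apply: leq_trans (leq_card_setU _ _); apply: subset_leq_card.
apply/subsetP=> r Gr; rewrite inE; case: (boolP (r \in H)) => //= Hr.
rewrite mem_lcoset.
have -> : (g^-1 = g)%g.
  by apply/rowP=> i'; rewrite mxE.
move: Gg Hg Gr Hr; rewrite !inE => Gg Hg Gr Hr.
rewrite bits_ofD.
by apply: (valid_to_fused Hk _ _ Gg Hg Gr Hr); rewrite ?size_bits_of.
Qed.

(** * Counting the loops of pairs of states *)

Definition piece_of (K : kind) (t : tangle) : piece :=
  match t with Cup => Min | Cap => Max | Cross _ => Joint K end.

(** The default [K] provides the constant decorations, with [ks] empty. *)
Fixpoint plug (K : kind) (w : seq letter) (ks : seq kind) : pword :=
  if w is (t, i) :: w' then
    if t is Cross _ then (Joint (head K ks), i) :: plug K w' (behead ks)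
    else (piece_of K t, i) :: plug K w' ks
  else [::].

Definition ncross (w : seq letter) : nat := count is_cross w.

Lemma plug_cat K u v k1 k2 : size k1 = ncross u ->
  plug K (u ++ v) (k1 ++ k2) = plug K u k1 ++ plug K v k2.
Proof.
elim: u k1 => [[] //|[[||s] i] u IH] k1 //= H; rewrite ?IH //.
by case: k1 H => //= k k1 [H]; rewrite IH.
Qed.

Lemma plug_cons K t i w :
  plug K ((t, i) :: w) [::] = (piece_of K t, i) :: plug K w [::].
Proof. by case: t. Qed.

Lemma nbits_plug K L w ks ls : nbits (plug K w ks) = nbits (plug L w ls).
Proof. elim: w ks ls => //= -[[||s] i] w IH ks ls /=; first by rewrite (IH _ ls).
  by rewrite (IH _ ls).
by rewrite (IH _ (behead ls)). Qed.

Lemma pstrands_plug n K w ks : pstrands n (plug K w ks) = strands n w.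
Proof. by elim: w n ks => //= -[[||s] i] w IH n ks /=; rewrite IH. Qed.

Section Fourier.
Local Open Scope ring_scope.

Fixpoint dot (x y : seq bool) : bool :=
  match x, y with
  | a :: x', b :: y' => (a && b) (+) dot x' y'
  | _, _ => false
  end.

(** The characters of the group of bit vectors. *)
Definition chi (x y : seq bool) : int := (-1) ^+ dot x y.

Lemma chi_cat x y x' y' : size x = size x' ->
  chi (x ++ y) (x' ++ y') = chi x x' * chi y y'.
Proof.
rewrite /chi -signr_addb => H; congr (_ ^+ nat_of_bool _).
by elim: x x' H => [|a x IH] [|b x'] //= [H]; rewrite IH // addbA.
Qed.

Definition is_cup (t : tangle) : bool := if t is Cup then true else false.

Definition cups (w : seq letter) : nat := count (fun l => is_cup l.1) w.
Definition caps (w : seq letter) : nat :=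
  count (fun l => if l.1 is Cap then true else false) w.

(** The Fourier transform takes a linear condition to the condition that defines the
    orthogonal space.  Equality of two labels is its own orthogonal, and [Parity]
    and [Fused] are exchanged; the powers of two normalize the transform. *)
Lemma fits_fourier t m o :
    size m = p_in (piece_of Parity t) -> size o = p_out (piece_of Parity t) ->
  2 ^+ is_cup t *
    (\sum_(x <- bits (p_in (piece_of Parity t)))
       chi x m * (fits (piece_of Parity t) x o)%:R : int) =
  2 ^+ (~~ is_cup t) *
    (\sum_(y <- bits (p_out (piece_of Parity t)))
       chi o y * (fits (piece_of Fused t) m y)%:R : int).
Proof.
case: t => [||s] /=.
- case: m o => [|? ?] // [|a [|b [|? ?]]] // _ _; rewrite !big_cons !big_nil.
  by case: a b => [] [].
- case: o m => [|? ?] // [|a [|b [|? ?]]] // _ _; rewrite !big_cons !big_nil.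
  by case: a b => [] [].
case: m o => [|a [|b [|? ?]]] // [|c [|d [|? ?]]] // _ _.
rewrite !big_cons !big_nil.
by case: a b c d => [] [] [] [].
Qed.

(** The local duality holds for every letter, so the transforms on the horizontal
    lines intertwine the labelings of the [Parity] diagram with those of the [Fused]
    diagram. *)
Lemma nlab_fourier w n y : strands n w = Some 0%N -> size y = n ->
  2 ^+ cups w * (\sum_(x <- bits n) chi x y * (nlab (plug Parity w [::]) x)%:R) =
  2 ^+ (caps w + ncross w) * (nlab (plug Fused w [::]) y)%:R :> int.
Proof.
elim: w n y => [|[t i] w IH] n y.
  by case=> -> /size0nil ->; rewrite big_seq1.
rewrite [strands _ _]/=; case: ifP => // Hi Hw Hy.
have [y1 [m [y3 [Ey Hy1 Hm]]]] : exists y1 m y3,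
    [/\ y = y1 ++ m ++ y3, size y1 = i & size m = ar_in t].
  by apply: split_at; rewrite Hy.
have Hin : p_in (piece_of Parity t) = ar_in t by case: (t).
have HinF : p_in (piece_of Fused t) = ar_in t by case: (t).
have Hout : p_out (piece_of Parity t) = ar_out t by case: (t).
have HoutF : p_out (piece_of Fused t) = ar_out t by case: (t).
pose r := size y3.
have Hn : n = (i + (ar_in t + r))%N by rewrite -Hy Ey !size_cat Hy1 Hm.
have Hn' : (n - ar_in t + ar_out t)%N = (i + (ar_out t + r))%N.
  by rewrite Hn; lia.
rewrite Hn' in Hw.
pose P z : int := (nlab (plug Parity w [::]) z)%:R.
pose Q z : int := (nlab (plug Fused w [::]) z)%:R.
have IH' o : size o = ar_out t ->
  2 ^+ cups w * (\sum_(x1 <- bits i) \sum_(z <- bits (ar_out t))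
     \sum_(x3 <- bits r) chi x1 y1 * chi z o * chi x3 y3 * P (x1 ++ z ++ x3)) =
  2 ^+ (caps w + ncross w) * Q (y1 ++ o ++ y3).
  move=> Ho; rewrite -(IH _ _ Hw) ?size_cat ?Hy1 ?Ho //.
  congr (_ * _); rewrite big_bits_cat big_seq [RHS]big_seq.
  apply: eq_bigr => x1 Hx1; rewrite big_bits_cat big_seq [RHS]big_seq.
  apply: eq_bigr => z Hz; apply: eq_bigr => x3 _.
  by rewrite !chi_cat ?(size_bits Hx1) ?(size_bits Hz) ?Ho // !mulrA.
have -> : cups ((t, i) :: w) = (is_cup t + cups w)%N.
  by case: (t).
have -> : (caps ((t, i) :: w) + ncross ((t, i) :: w) =
           ~~ is_cup t + (caps w + ncross w))%N.
  rewrite /caps /ncross /=; case: (t) => /=; lia.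
pose loc z : int := 2 ^+ is_cup t *
  (\sum_(x <- bits (ar_in t)) chi x m * (fits (piece_of Parity t) x z)%:R).
transitivity (2 ^+ cups w * \sum_(x1 <- bits i) \sum_(z <- bits (ar_out t))
    \sum_(x3 <- bits r) chi x1 y1 * chi x3 y3 * P (x1 ++ z ++ x3) * loc z).
  rewrite addnC exprD -mulrA; congr (_ * _).
  rewrite big_distrr {1}Hn big_bits_cat big_seq [RHS]big_seq.
  apply: eq_bigr => x1 Hx1; rewrite big_bits_cat.
  transitivity (\sum_(xm <- bits (ar_in t)) \sum_(x3 <- bits r)
    \sum_(z <- bits (ar_out t)) chi x1 y1 * chi x3 y3 * P (x1 ++ z ++ x3) *
      (2 ^+ is_cup t * (chi xm m * (fits (piece_of Parity t) xm z)%:R))).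
    rewrite big_seq [RHS]big_seq; apply: eq_bigr => xm Hxm.
    apply: eq_bigr => x3 _.
    rewrite Ey !chi_cat ?(size_bits Hx1) ?(size_bits Hxm) // plug_cons.
    rewrite nlabE ?(size_bits Hx1) ?(size_bits Hxm) // Hout natr_sum.
    rewrite !big_distrr /=; apply: eq_bigr => z _; rewrite natrM /P.
    ring.
  rewrite exchange_big [RHS]exchange_big /=; apply: eq_bigr => x3 _.
  rewrite exchange_big /=; apply: eq_bigr => z _.
  by rewrite /loc !big_distrr.
transitivity (2 ^+ (~~ is_cup t) * \sum_(o <- bits (ar_out t))
   (fits (piece_of Fused t) m o)%:R * (2 ^+ (caps w + ncross w) *
   Q (y1 ++ o ++ y3))); last first.
  rewrite [in RHS]exprD -mulrA Ey plug_cons nlabE //; last by rewrite HinF.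
  rewrite HoutF natr_sum !big_distrr /=; apply: eq_bigr => o _.
  by rewrite natrM /Q; ring.
have -> : \sum_(o <- bits (ar_out t)) (fits (piece_of Fused t) m o)%:R *
    (2 ^+ (caps w + ncross w) * Q (y1 ++ o ++ y3)) =
  \sum_(o <- bits (ar_out t)) (fits (piece_of Fused t) m o)%:R *
    (2 ^+ cups w * (\sum_(x1 <- bits i) \sum_(z <- bits (ar_out t))
     \sum_(x3 <- bits r) chi x1 y1 * chi z o * chi x3 y3 * P (x1 ++ z ++ x3))).
  rewrite big_seq [RHS]big_seq; apply: eq_bigr => o Ho.
  by rewrite IH' // (size_bits Ho).
transitivity (2 ^+ cups w * \sum_(o <- bits (ar_out t))
   \sum_(x1 <- bits i) \sum_(z <- bits (ar_out t)) \sum_(x3 <- bits r)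
   chi x1 y1 * chi x3 y3 * P (x1 ++ z ++ x3) * (2 ^+ (~~ is_cup t) *
     (chi z o * (fits (piece_of Fused t) m o)%:R))); last first.
  rewrite !big_distrr /=; apply: eq_bigr => o _.
  rewrite !big_distrr /=; apply: eq_bigr => x1 _.
  rewrite !big_distrr /=; apply: eq_bigr => z _.
  rewrite !big_distrr /=; apply: eq_bigr => x3 _; ring.
congr (_ * _); rewrite [RHS]exchange_big; apply: eq_bigr => x1 _.
rewrite [RHS]exchange_big big_seq [RHS]big_seq; apply: eq_bigr => z Hz.
rewrite [RHS]exchange_big; apply: eq_bigr => x3 _; rewrite -!big_distrr /=.
congr (_ * _); rewrite /loc -{1}Hin fits_fourier ?Hin ?Hout ?HoutF //.
by rewrite (size_bits Hz).
Qed.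

End Fourier.

Lemma cups_caps w n : strands n w = Some 0 -> n + 2 * cups w = 2 * caps w.
Proof.
elim: w n => [n [->] //|[t i] w IH] n; rewrite [strands _ _]/=.
case: ifP => // Hi /IH; rewrite /cups /caps /=; case: t Hi => [||s] /=; lia.
Qed.

(** Equivalently, the cycle space of a graph with [k] components whose [c] vertices
    all have degree 4 has dimension [c + k]. *)
Lemma nlab_parity w : strands 0 w = Some 0 ->
  nlab (plug Parity w [::]) [::] = 2 ^ ncross w * nlab (plug Fused w [::]) [::].
Proof.
move=> Hw; have := nlab_fourier Hw (erefl : size [::] = 0).
have -> : caps w = cups w by have := cups_caps Hw; lia.
rewrite big_seq1 /chi /= expr0 mul1r exprD -mulrA => /mulfI H.
have : ((2 ^+ cups w : int) != 0)%R by rewrite expf_eq0 andbF.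
by move=> /H /eqP; rewrite -natrX -natrM Num.Theory.eqr_nat => /eqP.
Qed.

Definition smoothing (b : bool) : kind := if b then Through else Turn.

Definition state (w : seq letter) (t : seq bool) : pword :=
  plug Fused w (map smoothing t).

Definition differences (t t' : seq bool) : nat :=
  count (fun p => p.1 != p.2) (zip t t').

Definition nonfused (ks : seq kind) : nat :=
  count (fun k => if k is Fused then false else true) ks.

Lemma nlab_fused u w ks : (forall j, nth Fused ks j <> Parity) ->
  nlab (u ++ plug Fused w ks) [::] <=
  2 ^ nonfused ks * nlab (u ++ plug Fused w [::]) [::].
Proof.
elim: w u ks => [|[t i] w IH] u ks Hks.
  by rewrite leq_pmull // expn_gt0.
have E p (ls : seq kind) : u ++ (p, i) :: plug Fused w ls =
    rcons u (p, i) ++ plug Fused w ls by rewrite cat_rcons.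
case: t => [||s] /=; [by rewrite !E; apply: IH..|].
have Hks' j : nth Fused (behead ks) j <> Parity.
  by rewrite nth_behead; apply: Hks.
case: ks Hks Hks' => [|k ks] Hks Hks' /=; first by rewrite mul1n.
have IHk := IH (rcons u (Joint Fused, i)) ks Hks'; rewrite -!E in IHk.
have Hk : k <> Parity := Hks 0.
have Hle : nlab (u ++ (Joint k, i) :: plug Fused w ks) [::] <=
    2 * (2 ^ nonfused ks * nlab (u ++ plug Fused ((Cross s, i) :: w) [::]) [::]).
  by apply: leq_trans (nlab_fuse _ _ _ Hk) _; rewrite leq_mul2l.
case: k Hk {Hks Hks'} Hle => // Hk Hle; rewrite ?add1n ?expnS -?mulnA //.
Qed.

(** Decorations whose labelings are valid in both of two states. *)
Definition common (t t' : seq bool) : seq kind :=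
  [seq (if p.1 == p.2 then smoothing p.1 else Fused) | p <- zip t t'].

Lemma valid_common w t t' x b : size t = ncross w -> size t' = ncross w ->
  valid (state w t) x b -> valid (state w t') x b ->
  valid (plug Fused w (common t t')) x b.
Proof.
elim: w t t' x b => //= -[[||s] i] w IH t t' x b Ht Ht' /=.
- by case/andP=> -> V1 /andP[_ V2]; apply: IH.
- by case/andP=> -> V1 /andP[_ V2]; apply: IH.
case: t t' Ht Ht' => [|a t] [|a' t'] //= [Ht] [Ht'].
case/andP=> F1 V1 /andP[F2 V2]; rewrite IH // andbT.
move: F1 F2; do 4 case: (nth _ _ _); by case: a a' {V1 V2} => [] [].
Qed.

Lemma word_sum_parity w ks ls : word_sum (plug Fused w ks) (plug Fused w ls)
  (plug Parity w [::]).
Proof.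
elim: w ks ls => [|[[||s] i] w IH] ks ls //=; split=> //; try exact: IH.
have even k a b c d : kfits k a b c d -> ~~ (a (+) b (+) c (+) d).
  by case: k a b c d => [] [] [] [] [].
move=> a b c d a' b' c' d' /even H1 /even H2.
by case: a b c d H1 a' b' c' d' H2 => [] [] [] [] // _ [] [] [] [].
Qed.

Lemma nonfused_common t t' : size t = size t' ->
  nonfused (common t t') + differences t t' = size t.
Proof.
elim: t t' => [|a t IH] [|a' t'] //= [/IH].
rewrite /nonfused /differences /common /=; case: (a == a') => /=; last by lia.
by case: a => /=; lia.
Qed.

Lemma common_not_parity t t' j : nth Fused (common t t') j <> Parity.
Proof.
elim: t t' j => [|a t IH] [|a' t'] [|j] //=; first by case: a a' => [] [].
exact: IH.
Qed.

(** The combinatorial heart of the crossing number bound.  For two states without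
    common smoothing it says that their numbers of loops add up to at most
    [c + 2 * k]; having it for all pairs of states avoids identifying the states
    that contribute the extreme degrees of the bracket.  Adding labelings of the
    two states gives labelings of the [Parity] diagram, whose number is known by
    duality, and two pairs with the same sum differ by a labeling valid in both
    states; where the smoothings agree, such a labeling may fail to be [Fused],
    at the cost of a factor two each time. *)
Lemma loops_pair w t t' : strands 0 w = Some 0 ->
    size t = ncross w -> size t' = ncross w ->
  loops (state w t) + loops (state w t') + differences t t' <=
  2 * ncross w + 2 * loops (plug Fused w [::]).
Proof.
move=> Hw Ht Ht'.
have H := @nlab_mul (state w t) (state w t') (plug Parity w [::])
   (plug Fused w (common t t')) (nbits_plug _ _ _ _ _) (nbits_plug _ _ _ _ _)
   (nbits_plug _ _ _ _ _) (word_sum_parity _ _ _)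
   (fun b => valid_common Ht Ht').
have /= H' := @nlab_fused [::] w _ (@common_not_parity t t').
have := leq_trans H (leq_mul (leqnn _) H'); rewrite nlab_parity //.
rewrite !nlab_loops -!expnD leq_exp2l //.
have := nonfused_common (etrans Ht (esym Ht')); rewrite Ht; lia.
Qed.

(** Each component of a diagram contains a loop of every state. *)
Lemma loops_state_ge w t :
  loops (plug Fused w [::]) <= loops (state w t).
Proof.
rewrite -(leq_exp2l _ _ (isT : 1 < 2)) -!nlab_loops.
suff: forall x, nlab (plug Fused w [::]) x <= nlab (state w t) x by apply.
elim: w t => //= -[[||s] i] w IH t x /=.
- by apply: leq_sum => o _; rewrite leq_mul2l IH orbT.
- by apply: leq_sum => o _; rewrite leq_mul2l IH orbT.
apply: leq_sum => o _; apply: leq_mul; last first.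
  by case: t => [|a t]; [apply: (IH [::]) | apply: IH].
by case: t => [|[] t] //=; do 4 case: (nth _ _ _).
Qed.

(** * The Kauffman bracket *)

Lemma strands_cat n u v :
  strands n (u ++ v) = obind (fun m => strands m v) (strands n u).
Proof. by elim: u n => //= -[k i] u IH n; case: ifP. Qed.

Lemma state_cat u v s t : size s = ncross u ->
  state (u ++ v) (s ++ t) = state u s ++ state v t.
Proof. by move=> H; rewrite /state map_cat plug_cat // size_map. Qed.

Lemma loops_local e U a b V m : pstrands 0 U = Some m ->
    (forall x, size x = m -> nlab (a ++ V) x = 2 ^ e * nlab (b ++ V) x) ->
  loops (U ++ a ++ V) = e + loops (U ++ b ++ V).
Proof.
move=> HU H; apply: (@expnI 2) => //.
by rewrite expnD -!nlab_loops; apply: (nlab_cat HU).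
Qed.

Section Bracket.
Local Open Scope ring_scope.
Variable R : comNzRingType.
Implicit Types (A B : R) (u v w : seq letter).

Definition sign_of (l : letter) : bool := if l.1 is Cross s then s else false.
Definition signs w : seq bool := [seq sign_of l | l <- w & is_cross l].

Lemma size_signs w : size (signs w) = ncross w.
Proof. by rewrite size_map size_filter. Qed.

(** A crossing of sign [s] contributes [A] when its smoothing [t] is [Through] and
    [s] holds, or when it is [Turn] and [s] does not hold. *)
Definition weight A B (s t : seq bool) : R :=
  \prod_(p <- zip s t) (if p.1 == p.2 then A else B).

Lemma weight_cat A B s t s' t' : size s = size t ->
  weight A B (s ++ s') (t ++ t') = weight A B s t * weight A B s' t'.
Proof. by move=> H; rewrite /weight zip_cat // big_cat. Qed.

(** The value of a loop. *)
Definition delta A B : R := - A ^+ 2 - B ^+ 2.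

(** Kauffman's bracket, not normalized: the empty diagram has value 1.  Any [A], [B]
    with [A * B = 1] in a commutative ring may be used, which later allows both
    rational values and values modulo an integer. *)
Definition bracket A B w : R :=
  \sum_(t <- bits (ncross w))
    weight A B (signs w) t * delta A B ^+ loops (state w t).

Lemma ncross_cat u v : ncross (u ++ v) = (ncross u + ncross v)%N.
Proof. exact: count_cat. Qed.

Lemma bracket_cat3 A B u a v :
  bracket A B (u ++ a ++ v) =
  \sum_(s <- bits (ncross u)) \sum_(t <- bits (ncross v))
    weight A B (signs u) s * weight A B (signs v) t *
    \sum_(r <- bits (ncross a)) weight A B (signs a) r *
      delta A B ^+ loops (state u s ++ state a r ++ state v t).
Proof.
rewrite /bracket !ncross_cat big_bits_cat big_seq [RHS]big_seq.
apply: eq_bigr => s Hs; rewrite big_bits_cat.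
transitivity (\sum_(r <- bits (ncross a)) \sum_(t <- bits (ncross v))
   weight A B (signs u) s * weight A B (signs v) t * (weight A B (signs a) r *
      delta A B ^+ loops (state u s ++ state a r ++ state v t))).
  rewrite big_seq [RHS]big_seq; apply: eq_bigr => r Hr; apply: eq_bigr => t _.
  rewrite /signs !filter_cat !map_cat -!/(signs _).
  rewrite !weight_cat ?size_signs ?(size_bits Hs) ?(size_bits Hr) //.
  by rewrite !state_cat ?(size_bits Hs) ?(size_bits Hr) //; ring.
by rewrite exchange_big; apply: eq_bigr => t _; rewrite -big_distrr.
Qed.

(** Relations between crossingless tangles reduce to counting labelings, which is
    where invariance under plane isotopy comes from. *)
Lemma bracket_planar A B u a b v e m : strands 0 u = Some m ->
    ncross a = 0%N -> ncross b = 0%N ->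
    (forall V x, size x = m -> nlab (plug Fused a [::] ++ V) x =
                               2 ^ e * nlab (plug Fused b [::] ++ V) x)%N ->
  bracket A B (u ++ a ++ v) = delta A B ^+ e * bracket A B (u ++ b ++ v).
Proof.
move=> Hu Ha Hb H; rewrite !bracket_cat3 big_distrr /=.
apply: eq_bigr => s _; rewrite big_distrr; apply: eq_bigr => t _ /=.
rewrite Ha Hb !big_seq1 /weight.
have Sa : signs a = [::] by apply/size0nil; rewrite size_signs.
have Sb : signs b = [::] by apply/size0nil; rewrite size_signs.
rewrite Sa Sb !big_nil (@loops_local e _ (state a [::]) (state b [::]) _ m) ?exprD.
- by ring.
- by rewrite pstrands_plug.
by move=> x Hx; apply: H.
Qed.

Lemma bracket_skein A B u v s i m : strands 0 u = Some m -> (i + 2 <= m)%N ->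
  bracket A B (u ++ (Cross s, i) :: v) =
  (if s then A else B) * bracket A B (u ++ v) +
  (if s then B else A) * bracket A B (u ++ [:: (Cap, i); (Cup, i)] ++ v).
Proof.
move=> Hu Hi; rewrite -cat1s -[in bracket A B (u ++ v)](cat0s v) !bracket_cat3.
rewrite !big_distrr -big_split; apply: eq_bigr => p _ /=.
rewrite !big_distrr -big_split; apply: eq_bigr => q _ /=.
rewrite !big_cons !big_nil /=.
rewrite /weight /signs /= !big_cons !big_nil.
have HU : pstrands 0 (state u p) = Some m by rewrite pstrands_plug.
have -> : loops (state u p ++ (Joint Through, i) :: state v q) =
          loops (state u p ++ state v q).
  apply: (@loops_local 0 _ [:: (Joint Through, i)] [::] _ m) => // x Hx.
  by rewrite nlab_through ?Hx // mul1n.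
have -> : loops (state u p ++ (Joint Turn, i) :: state v q) =
          loops (state u p ++ [:: (Max, i); (Min, i)] ++ state v q).
  apply: (@loops_local 0 _ [:: (Joint Turn, i)] _ _ m) => // x Hx.
  by rewrite nlab_turn ?Hx // mul1n.
by case: s => /=; ring.
Qed.

Lemma bracket_loop A B u v i m : strands 0 u = Some m -> (i <= m)%N ->
  bracket A B (u ++ [:: (Cup, i), (Cap, i) & v]) = delta A B * bracket A B (u ++ v).
Proof.
move=> Hu Hi; apply: (@bracket_planar _ _ _ [:: _; _] [::] _ 1 m) => // V x Hx.
by rewrite nlab_loop ?Hx.
Qed.

Lemma bracket_zigzagL A B u v i m : strands 0 u = Some m -> (i < m)%N ->
  bracket A B (u ++ [:: (Cup, i), (Cap, i.+1) & v]) = bracket A B (u ++ v).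
Proof.
move=> Hu Hi; rewrite -[RHS]mul1r.
apply: (@bracket_planar _ _ _ [:: _; _] [::] _ 0 m) => // V x Hx.
by rewrite nlab_zigzagL ?Hx ?mul1n.
Qed.

Lemma bracket_zigzagR A B u v i m : strands 0 u = Some m -> (i < m)%N ->
  bracket A B (u ++ [:: (Cup, i.+1), (Cap, i) & v]) = bracket A B (u ++ v).
Proof.
move=> Hu Hi; rewrite -[RHS]mul1r.
apply: (@bracket_planar _ _ _ [:: _; _] [::] _ 0 m) => // V x Hx.
by rewrite nlab_zigzagR ?Hx ?mul1n.
Qed.

Lemma bracket_exchange0 A B u v k l i d m : ~~ is_cross (k, i) ->
    ~~ is_cross (l, i) ->
    strands 0 u = Some m -> (i + ar_in k + d + ar_in l <= m)%N ->
  bracket A B (u ++ [:: (k, i), (l, i + ar_out k + d)%N & v]) =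
  bracket A B (u ++ [:: (l, i + ar_in k + d)%N, (k, i) & v]).
Proof.
move=> Hk Hl Hu Hi; rewrite -[RHS]mul1r.
apply: (@bracket_planar _ _ _ [:: _; _] [:: _; _] _ 0 m) => //.
- by rewrite /ncross /= (negbTE Hk); case: (l) Hl.
- by rewrite /ncross /= (negbTE Hk); case: (l) Hl.
move=> V x Hx; rewrite mul1n.
case: k Hk Hi => // _ Hi; case: l Hl Hi => // _ Hi /=.
- by apply: (@nlab_exchange Min Min); rewrite Hx.
- by apply: (@nlab_exchange Min Max); rewrite Hx.
- by apply: (@nlab_exchange Max Min); rewrite Hx.
by apply: (@nlab_exchange Max Max); rewrite Hx.
Qed.

End Bracket.

(** * Invariance of the bracket *)

Lemma strands_rcons u m k i : strands 0 u = Some m -> i + ar_in k <= m ->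
  strands 0 (rcons u (k, i)) = Some (m - ar_in k + ar_out k).
Proof. by move=> Hu Hi; rewrite -cats1 strands_cat Hu /= Hi. Qed.

Section Invariance.
Local Open Scope ring_scope.
Variables (R : comNzRingType) (A B : R).
Hypothesis AB : A * B = 1.
Implicit Types (u v : seq letter).
Local Notation br := (bracket A B).
Local Notation w_through s := (if s then A else B).
Local Notation w_turn s := (if s then B else A).

(** Exchange moves that involve crossings follow from those of cups and caps by
    smoothing.  Here only the lower letter can be a crossing. *)
Lemma bracket_exchange1 u v k l i d m : ~~ is_cross (l, i) ->
    strands 0 u = Some m -> (i + ar_in k + d + ar_in l <= m)%N ->
  br (u ++ [:: (k, i), (l, i + ar_out k + d)%N & v]) =
  br (u ++ [:: (l, i + ar_in k + d)%N, (k, i) & v]).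
Proof.
move=> Hl Hu Hm; case: k Hm => [||s] Hm; try exact: bracket_exchange0 Hu Hm.
rewrite /= in Hm *.
rewrite (@bracket_skein _ _ _ _ _ s _ m) //; last by lia.
rewrite -[in RHS](cat_rcons (l, _)) (@bracket_skein _ _ _ _ _ s _ (m - ar_in l + ar_out l)%N).
- rewrite !cat_rcons; congr (_ + _ * _).
  rewrite -(cat_rcons (Cap, i)).
  have := @bracket_exchange0 R A B (rcons u (Cap, i)) v Cup l i d (m - 2)%N.
  rewrite /= !addn0 => ->; rewrite //; first last.
  + by lia.
  + by rewrite (strands_rcons Hu) /=; [congr Some; lia | lia].
  have := @bracket_exchange0 R A B u ((Cup, i) :: v) Cap l i d m.
  by rewrite /= !addn0 cat_rcons => ->.
- by rewrite (strands_rcons Hu) //; lia.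
by case: (l) Hl Hm => //=; lia.
Qed.

Lemma bracket_exchange u v k l i d m :
    strands 0 u = Some m -> (i + ar_in k + d + ar_in l <= m)%N ->
  br (u ++ [:: (k, i), (l, i + ar_out k + d)%N & v]) =
  br (u ++ [:: (l, i + ar_in k + d)%N, (k, i) & v]).
Proof.
move=> Hu Hm; case: l Hm => [||s] Hm; try exact: bracket_exchange1 Hu Hm.
rewrite /= in Hm.
have Hk : strands 0 (rcons u (k, i)) = Some (m - ar_in k + ar_out k)%N.
  by apply: strands_rcons Hu _; lia.
rewrite -cat_rcons (bracket_skein _ _ _ _ Hk); last by lia.
rewrite (bracket_skein _ _ _ _ Hu) //.
rewrite !cat_rcons; congr (_ + _ * _).
have -> := @bracket_exchange1 u ((Cup, i + ar_out k + d)%N :: v) k Cap i d m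
  isT Hu Hm.
rewrite -!(cat_rcons (Cap, _)).
have -> // := @bracket_exchange1 (rcons u (Cap, i + ar_in k + d)%N) v k Cup i d (m - 2)%N.
- by rewrite (strands_rcons Hu) /= ?addn0.
by rewrite /=; lia.
Qed.

Lemma bracket_R1Cup u v s i m : strands 0 u = Some m -> (i <= m)%N ->
  br (u ++ [:: (Cup, i), (Cross s, i) & v]) =
  - w_turn s ^+ 3 * br (u ++ (Cup, i) :: v).
Proof.
move=> Hu Hi; have Hc : strands 0 (rcons u (Cup, i)) = Some (m + 2)%N.
  by rewrite (strands_rcons Hu) /= ?addn0 ?subn0.
rewrite -cat_rcons (bracket_skein _ _ _ _ Hc); last by lia.
rewrite !cat_rcons (bracket_loop _ _ _ Hu) // /delta mulrA -mulrDl.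
by congr (_ * _); case: s; ring: AB.
Qed.

Lemma bracket_R1Cap u v s i m : strands 0 u = Some m -> (i + 2 <= m)%N ->
  br (u ++ [:: (Cross s, i), (Cap, i) & v]) =
  - w_turn s ^+ 3 * br (u ++ (Cap, i) :: v).
Proof.
move=> Hu Hi; have Hc : strands 0 (rcons u (Cap, i)) = Some (m - 2)%N.
  by rewrite (strands_rcons Hu) /= ?addn0.
rewrite (bracket_skein _ _ _ _ Hu) //.
rewrite /= -(cat_rcons (Cap, i) u ((Cup, i) :: _)) (bracket_loop _ _ _ Hc) //; last by lia.
rewrite !cat_rcons /delta mulrA -mulrDl.
by congr (_ * _); case: s; ring: AB.
Qed.

Lemma bracket_R2 u v s i m : strands 0 u = Some m -> (i + 2 <= m)%N ->
  br (u ++ [:: (Cross s, i), (Cross (~~ s), i) & v]) = br (u ++ v).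
Proof.
move=> Hu Hi; have Hc : strands 0 (rcons u (Cap, i)) = Some (m - 2)%N.
  by rewrite (strands_rcons Hu) /= ?addn0.
rewrite (bracket_skein _ _ _ _ Hu) // (bracket_skein _ _ _ _ Hu) //.
rewrite /= -(cat_rcons (Cap, i) u [:: (Cup, i), (Cross _, i) & _]).
rewrite (bracket_R1Cup _ _ Hc); last by lia.
rewrite cat_rcons; move: (br _) (br _) => x y.
by case: s => /=; ring: AB.
Qed.

Lemma bracket_swingCap u v s i m : strands 0 u = Some m -> (i + 3 <= m)%N ->
  br (u ++ [:: (Cross s, i), (Cap, i.+1) & v]) =
  br (u ++ [:: (Cross (~~ s), i.+1), (Cap, i) & v]).
Proof.
move=> Hu Hi.
have Hc j : (j + 2 <= m)%N -> strands 0 (rcons u (Cap, j)) = Some (m - 2)%N.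
  by move=> Hj; rewrite (strands_rcons Hu) /= ?addn0.
rewrite (bracket_skein _ _ _ _ Hu); last by lia.
rewrite [RHS](bracket_skein _ _ _ _ Hu); last by lia.
rewrite /= -(cat_rcons (Cap, i) u ((Cup, i) :: _)).
rewrite -(cat_rcons (Cap, i.+1) u ((Cup, i.+1) :: _)).
rewrite (bracket_zigzagL _ _ _ (Hc i _)); try lia.
rewrite (bracket_zigzagR _ _ _ (Hc i.+1 _)); try lia.
by rewrite !cat_rcons addrC; case: s.
Qed.

Lemma bracket_swingCup u v s i m : strands 0 u = Some m -> (i.+1 <= m)%N ->
  br (u ++ [:: (Cup, i), (Cross s, i.+1) & v]) =
  br (u ++ [:: (Cup, i.+1), (Cross (~~ s), i) & v]).
Proof.
move=> Hu Hi.
have Hc j : (j <= m)%N -> strands 0 (rcons u (Cup, j)) = Some (m + 2)%N.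
  by move=> Hj; rewrite (strands_rcons Hu) /= ?addn0 ?subn0.
rewrite -(cat_rcons (Cup, i)) (bracket_skein _ _ _ _ (Hc i _)); try lia.
rewrite -(cat_rcons (Cup, i.+1) u ((Cross _, i) :: _)).
rewrite (bracket_skein _ _ _ _ (Hc i.+1 _)); try lia.
rewrite !cat_rcons (bracket_zigzagL _ _ _ Hu) //.
rewrite (bracket_zigzagR _ _ _ Hu) //.
by rewrite addrC; case: s.
Qed.

(** Kauffman's argument: after smoothing one crossing on each side, the first terms
    agree, and in the second terms the remaining strand slides off the turn by a
    swing and a second Reidemeister move. *)
Lemma bracket_R3 u v s i m : strands 0 u = Some m -> (i + 3 <= m)%N ->
  br (u ++ [:: (Cross s, i), (Cross s, i.+1), (Cross s, i) & v]) =
  br (u ++ [:: (Cross s, i.+1), (Cross s, i), (Cross s, i.+1) & v]).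
Proof.
move=> Hu Hi.
have Hx j : (j + 2 <= m)%N -> strands 0 (rcons u (Cross s, j)) = Some m.
  by move=> Hj; rewrite (strands_rcons Hu) //= subnK //; lia.
have Hxx : strands 0 (rcons (rcons u (Cross s, i.+1)) (Cross s, i)) = Some m.
  rewrite (strands_rcons (Hx i.+1 _)) /=; try lia.
  by congr Some; lia.
have Hc : strands 0 (rcons u (Cap, i)) = Some (m - 2)%N.
  by rewrite (strands_rcons Hu) /= ?addn0 //; lia.
rewrite (bracket_skein _ _ _ _ Hu); last by lia.
rewrite -[in RHS](cat_rcons (Cross s, i.+1)) -[in RHS](cat_rcons (Cross s, i)).
rewrite (bracket_skein _ _ _ _ Hxx); last by lia.
rewrite !cat_rcons /=; congr (_ + _ * _).
(* Both second terms are a cap followed by a shifted cup. *)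
transitivity (br (u ++ [:: (Cap, i), (Cup, i.+1) & v])).
  rewrite -(cat_rcons (Cap, i)) (bracket_swingCup _ _ Hc); last by lia.
  rewrite -(cat_rcons (Cup, i.+1)).
  have := @bracket_R2 (rcons (rcons u (Cap, i)) (Cup, i.+1)) v (~~ s) i m.
  rewrite negbK => ->; rewrite ?cat_rcons //; last by lia.
  by rewrite (strands_rcons Hc) /=; [congr Some; lia | lia].
rewrite -(cat_rcons (Cross s, i.+1)) (bracket_swingCap _ _ (Hx i.+1 _)); try lia.
rewrite cat_rcons (bracket_R2 _ _ Hu) //; lia.
Qed.

(** Unoriented diagrams have no writhe to correct the bracket with, so a first
    Reidemeister move multiplies it by a unit, recorded by the sign of the
    crossing. *)
Definition R1_factor (f : option bool) : R :=
  if f is Some s then - w_turn s ^+ 3 else 1.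

End Invariance.

Lemma bracket_move u v a b : move a b ->
    strands 0 (u ++ a ++ v) = Some 0 -> strands 0 (u ++ b ++ v) = Some 0 ->
  exists f, forall (R : comNzRingType) (A B : R), (A * B = 1)%R ->
    (bracket A B (u ++ a ++ v) = R1_factor A B f * bracket A B (u ++ b ++ v))%R.
Proof.
move=> Hab; rewrite !strands_cat; case Hu : (strands 0 u) => [m|] //=.
case: Hab => [k l i d|i|i|s i|s i|s i|s i|s i|s i] /=.
- move=> Ha Hb; exists None => R A B AB; rewrite mul1r.
  apply: (bracket_exchange _ _ _ Hu).
  by move: Hb; case: ifP => //; lia.
- case: ifP => // H1; case: ifP => // H2 _ _.
  exists None => R A B AB; rewrite mul1r; apply: bracket_zigzagL Hu _; lia.
- case: ifP => // H1; case: ifP => // H2 _ _.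
  exists None => R A B AB; rewrite mul1r; apply: bracket_zigzagR Hu _; lia.
- case: ifP => // H1; case: ifP => // H2 _ _.
  exists None => R A B AB; rewrite mul1r; apply: bracket_swingCap Hu _; lia.
- case: ifP => // H1; case: ifP => // H2 _ H3.
  exists None => R A B AB; rewrite mul1r; apply: bracket_swingCup Hu _; lia.
- case: ifP => // H1; case: ifP => // H2 _ _.
  exists (Some s) => R A B AB; apply: bracket_R1Cap Hu _ => //; lia.
- case: ifP => // H1; case: ifP => // H2 _ _.
  exists (Some s) => R A B AB; apply: bracket_R1Cup Hu _ => //; lia.
- case: ifP => // H1; case: ifP => // H2 _ _.
  exists None => R A B AB; rewrite mul1r; apply: bracket_R2 Hu _ => //; lia.
case: ifP => // H1; case: ifP => // H2 _ _.
exists None => R A B AB; rewrite mul1r; apply: bracket_R3 Hu _ => //; lia.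
Qed.

Section Norm.
Local Open Scope ring_scope.
Variables (R : comNzRingType) (A B : R).
Hypothesis AB : A * B = 1.

(** Exchanging [A] and [B] inverts the unit of [R1_factor], so the product is an
    invariant of the link.  Its degree in [A] is the span of the bracket. *)
Definition bracket_norm (w : seq letter) : R := bracket A B w * bracket B A w.

Lemma bracket_norm_equiv D D' : link_equiv D D' ->
  bracket_norm D = bracket_norm D'.
Proof.
elim=> {D D'} [D D' [u [v [a [b [Hab Da Db]]]]]|D|D D' _ ->|D D' D'' _ -> _ ->] //.
have /eqP := wordP D; have /eqP := wordP D'; rewrite Da Db => Hb Ha.
have [f Hf] := bracket_move Hab Ha Hb.
rewrite /bracket_norm (Hf _ _ _ AB) (Hf _ _ _ (etrans (mulrC B A) AB)).
rewrite mulrACA -[RHS]mul1r; congr (_ * _).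
by case: f {Hf} => [[]|] /=; ring: AB.
Qed.

End Norm.

(** * The bracket of C(m, 2, n) *)

Section Twist.
Local Open Scope ring_scope.
Variable (R : comNzRingType).

(** A twist region of [n] crossings is a combination of the trivial tangle, with
    coefficient [a ^+ n], and of the turn, with coefficient [twist a b n]. *)
Fixpoint twist (a b : R) (n : nat) : R :=
  if n is n'.+1 then a * twist a b n' + b * (- b ^+ 3) ^+ n' else 0.

(** The bracket of the standard diagram of C(m, 2, n) divided by the value of a
    loop.  The middle crossings contribute [A ^+ 6] and [A ^+ 4 + B ^+ 4]. *)
Definition conway_factor (A B : R) (m n : nat) : R :=
  A ^+ 6 * (delta A B * A ^+ m * A ^+ n
            + twist A B m * A ^+ n + A ^+ m * twist A B n)
  - (A ^+ 4 + B ^+ 4) * twist A B m * twist A B n.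

Variables A B : R.
Hypothesis AB : A * B = 1.
Local Notation br := (bracket A B).
Local Notation d := (delta A B).
Local Notation w_through s := (if s then A else B).
Local Notation w_turn s := (if s then B else A).

Lemma bracket_twist_cup u v s i n m : strands 0 u = Some m -> (i <= m)%N ->
  br (u ++ (Cup, i) :: nseq n (Cross s, i) ++ v) =
  (- w_turn s ^+ 3) ^+ n * br (u ++ (Cup, i) :: v).
Proof.
move=> Hu Hi; elim: n => [|n IH]; first by rewrite mul1r.
by rewrite (bracket_R1Cup AB _ _ Hu) // IH mulrA -exprS.
Qed.

Lemma bracket_twist u v s i n m : strands 0 u = Some m -> (i + 2 <= m)%N ->
  br (u ++ nseq n (Cross s, i) ++ v) =
  w_through s ^+ n * br (u ++ v) +
  twist (w_through s) (w_turn s) n * br (u ++ [:: (Cap, i), (Cup, i) & v]).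
Proof.
move=> Hu Hi; elim: n => [|n IH]; first by rewrite mul1r mul0r addr0.
have Hc : strands 0 (rcons u (Cap, i)) = Some (m - 2)%N.
  by rewrite (strands_rcons Hu) /= ?addn0.
rewrite [nseq _ _]/= cat_cons (bracket_skein _ _ _ _ Hu) // IH /=.
rewrite -(cat_rcons (Cap, i) u [:: (Cup, i) & nseq _ _ ++ _]).
rewrite (bracket_twist_cup _ _ _ Hc); last by lia.
rewrite cat_rcons; move: (br _) (br _) (twist _ _ _) ((- _) ^+ n) => x y z c.
by rewrite exprS; ring.
Qed.

Lemma bracket_nil : br [::] = 1.
Proof.
rewrite /bracket big_seq1 /weight big_nil mul1r.
by rewrite /loops /= trunc_log1.
Qed.

Local Notation C i := (Cup, i%N).
Local Notation K i := (Cap, i%N).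

(** The names of the next lemmas list the turns between the cups and caps: [E] is a
    turn of the middle strands and [F] a turn of the first two. *)
Definition plat (w : seq letter) : seq letter := [:: C 0; C 2] ++ w ++ [:: K 0; K 0].

Lemma plat_nil : br (plat [::]) = d ^+ 2.
Proof.
have /= <- := @bracket_exchange _ A B [:: C 0] [:: K 0] Cap Cup 0 0 2 erefl isT.
rewrite (@bracket_loop _ A B [::] _ 0 0) // (@bracket_loop _ A B [::] _ 0 0) //.
by rewrite bracket_nil mulr1.
Qed.

Lemma plat_E : br (plat [:: K 1; C 1]) = d.
Proof.
rewrite /plat /= (@bracket_zigzagR _ A B [:: C 0] _ 1 2) //=.
rewrite (@bracket_zigzagR _ A B [:: C 0] _ 0 2) //=.
by rewrite (@bracket_loop _ A B [::] _ 0 0) // bracket_nil mulr1.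
Qed.

Lemma plat_F : br (plat [:: K 0; C 0]) = d ^+ 3.
Proof.
rewrite /plat /= (@bracket_loop _ A B [:: C 0; C 2; K 0] _ 0 2) //=.
by rewrite exprS -plat_nil.
Qed.

Lemma plat_EF : br (plat [:: K 1; C 1; K 0; C 0]) = d ^+ 2.
Proof.
rewrite /plat /= (@bracket_loop _ A B [:: C 0; C 2; K 1; C 1; K 0] _ 0 2) //=.
by have /= -> := plat_E.
Qed.

Lemma plat_FE : br (plat [:: K 0; C 0; K 1; C 1]) = d ^+ 2.
Proof.
rewrite /plat /= (@bracket_zigzagL _ A B [:: C 0; C 2; K 0] _ 0 2) //=.
rewrite (@bracket_zigzagR _ A B [:: C 0; C 2; K 0] _ 0 2) //=.
exact: plat_nil.
Qed.

Lemma plat_EE : br (plat [:: K 1; C 1; K 1; C 1]) = d ^+ 2.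
Proof.
rewrite /plat /= (@bracket_loop _ A B [:: C 0; C 2; K 1] _ 1 2) //=.
by have /= -> := plat_E.
Qed.

Lemma plat_EFE : br (plat [:: K 1; C 1; K 0; C 0; K 1; C 1]) = d.
Proof.
rewrite /plat /= (@bracket_zigzagL _ A B [:: C 0; C 2; K 1; C 1; K 0] _ 0 2) //=.
rewrite (@bracket_zigzagR _ A B [:: C 0; C 2; K 1; C 1; K 0] _ 0 2) //=.
exact: plat_E.
Qed.

(** Smoothing the three twist regions gives eight crossingless diagrams. *)
Lemma bracket_conway m n :
  br (conway_word [:: m; 2; n]) = d * conway_factor A B m n.
Proof.
rewrite /conway_word /= cats0 -!catA /=.
pose X k := nseq k (Cross true, 1%N).
rewrite -!/(X _).
have e0 u w : br (C 0 :: C 2 :: u ++ w) = br ([:: C 0; C 2] ++ u ++ w) by [].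
rewrite (@bracket_twist [:: C 0; C 2] _ true 1 m 4) //=.
have t2 u w k : strands 0 u = Some k -> (2 <= k)%N ->
  br (u ++ [:: (Cross false, 0%N), (Cross false, 0%N) & w]) =
  B ^+ 2 * br (u ++ w) + (1 - A ^+ 4) * br (u ++ [:: K 0, C 0 & w]).
  move=> Hu Hk; have := @bracket_twist u w false 0 2 k Hu Hk.
  rewrite /= => ->; congr (_ + _ * _).
  by rewrite !mulr0 expr0 expr1 !add0r; ring: AB.
have t1 u k : strands 0 u = Some k -> (3 <= k)%N ->
  br (u ++ X n ++ [:: K 0; K 0]) =
  A ^+ n * br (u ++ [:: K 0; K 0]) +
  twist A B n * br (u ++ [:: K 1; C 1; K 0; K 0]).
  by move=> Hu Hk; apply: (@bracket_twist u _ true 1 n k).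
have /= -> := t2 [:: C 0; C 2] (X n ++ [:: K 0; K 0]) 4%N erefl isT.
have /= -> := t2 [:: C 0; C 2; K 1; C 1] (X n ++ [:: K 0; K 0]) 4%N erefl isT.
have /= -> := t1 [:: C 0; C 2] 4%N erefl isT.
have /= -> := t1 [:: C 0; C 2; K 1; C 1] 4%N erefl isT.
have /= -> := t1 [:: C 0; C 2; K 0; C 0] 4%N erefl isT.
have /= -> := t1 [:: C 0; C 2; K 1; C 1; K 0; C 0] 4%N erefl isT.
have /= -> := plat_nil; have /= -> := plat_E; have /= -> := plat_F.
have /= -> := plat_EF; have /= -> := plat_FE; have /= -> := plat_EE.
have /= -> := plat_EFE.
rewrite /conway_factor /delta; move: (twist _ _ _) (twist _ _ _) => x y.
move: (A ^+ m) (A ^+ n) => a b.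
by ring: AB.
Qed.

(** Modulo [delta A B], that is at [A ^+ 4 = -1], the two eigenvalues [A] and
    [- B ^+ 3] of a crossing coincide. *)
Lemma twist_delta n :
  exists r, twist A B n = n%:R * A ^+ n * B ^+ 2 + d * r.
Proof.
have pow k : exists r, (- B ^+ 3) ^+ k = A ^+ k + d * r.
  elim: k => [|k [r Hr]]; first by exists 0; rewrite mulr0 addr0.
  exists (A * r + B * A ^+ k + B * d * r); rewrite exprS Hr [A ^+ k.+1]exprS /delta.
  by move: (A ^+ k) => a; ring: AB.
elim: n => [|n [r Hr]] /=; first by exists 0; rewrite !mul0r mulr0 addr0.
have [q ->] := pow n; exists (A * r + B * q).
rewrite Hr -natr1 [A ^+ n.+1]exprS; move: (A ^+ n) (n%:R) => a k; ring: AB.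
Qed.

(** The determinant of the link: the numerator of the fraction
    m + 1 / (2 + 1 / n). *)
Definition conway_det (m n : nat) : nat := m + n + 2 * m * n.

Lemma conway_factor_delta m n : exists r,
  conway_factor A B m n = - A ^+ (m + n) * (conway_det m n)%:R + d * r.
Proof.
have [p Hp] := twist_delta m; have [q Hq] := twist_delta n.
rewrite /conway_factor Hp Hq /conway_det exprD !natrD !natrM.
move: (A ^+ m) (A ^+ n) (m%:R) (n%:R) => a b k l.
exists (A ^+ 6 * (a * b + p * b + a * q)
  - a * b * (k + l) * A ^+ 2 
  - (A ^+ 4 + B ^+ 4) * (k * a * B ^+ 2 * q + l * b * B ^+ 2 * p + d * p * q)
  - d * (k * l * a * b * B ^+ 4)
  - 2 * k * l * a * b * B ^+ 2).
rewrite /delta. ring: AB.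
Qed.

End Twist.

(** * Connectedness of diagrams of C(m, 2, n) *)

Section Specializations.
Local Open Scope ring_scope.

Lemma bracket_dvd (R : comNzRingType) (A B : R) w k :
    (k <= loops (plug Fused w [::]))%N ->
  exists r, bracket A B w = delta A B ^+ k * r.
Proof.
move=> Hk; exists (\sum_(t <- bits (ncross w))
  weight A B (signs w) t * delta A B ^+ (loops (state w t) - k)).
rewrite big_distrr; apply: eq_bigr => t _ /=.
by rewrite mulrCA -exprD subnKC //; apply: leq_trans Hk (loops_state_ge w t).
Qed.

Lemma deltaC (R : comNzRingType) (A B : R) : delta A B = delta B A.
Proof. by rewrite /delta; ring. Qed.

Lemma conway_norm_delta (R : comNzRingType) (A B : R) m n : A * B = 1 ->
  exists r, bracket_norm A B (conway [:: m; 2; n]) =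
    delta A B ^+ 2 * ((conway_det m n)%:R ^+ 2 + delta A B * r).
Proof.
move=> AB; have BA : B * A = 1 by rewrite mulrC.
have [p Hp] := conway_factor_delta AB m n.
have [q Hq] := conway_factor_delta BA m n.
rewrite /bracket_norm !bracket_conway // Hp Hq -(deltaC A B).
have : A ^+ (m + n) * B ^+ (m + n) = 1 by rewrite -exprMn AB expr1n.
move: (A ^+ (m + n)) (B ^+ (m + n)) (_ %:R) (delta A B) => a b k e ab.
exists (- a * k * q - b * k * p + e * p * q); ring: ab.
Qed.

Lemma Zp_nat_eq0 q k : (1 < q)%N -> ((k%:R : 'Z_q) == 0) = (q %| k)%N.
Proof. by move=> Hq; rewrite -val_eqE /= val_Zp_nat. Qed.

(** The bracket of a disconnected diagram is divisible by the square of the value of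
    a loop; the nonzero determinant of C(m, 2, n) prevents this.  To see the
    difference, take [A] equal to the determinant [t] modulo [p ^ 3], where
    [p = t ^ 4 + 1].  The value of a loop is then a unit times [p], so its cube
    vanishes, and [bracket_norm] is zero for a disconnected diagram but a unit times
    [p ^ 2 * t ^ 2] for C(m, 2, n). *)
Lemma conway_connected (D : diagram) m n : (0 < m)%N ->
  link_equiv D (conway [:: m; 2; n]) -> (loops (plug Fused D [::]) <= 1)%N.
Proof.
move=> Hm HD; rewrite leqNgt; apply/negP => Hk.
pose t := conway_det m n; pose p := (t ^ 4 + 1)%N.
have Ht : (0 < t)%N by rewrite /t /conway_det; lia.
have Hp : (1 < p ^ 3)%N.
  have : (1 < p)%N by rewrite /p addn1 ltnS expn_gt0 Ht.
  by move=> Hp; rewrite -(exp1n 3) ltn_exp2r.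
pose R : comNzRingType := 'Z_(p ^ 3).
(* [B] inverts [A] because [A ^+ 4 = p - 1] and [p ^+ 3 = 0]. *)
pose A : R := t%:R; pose P : R := p%:R; pose B : R := - A ^+ 3 * (1 + P + P ^+ 2).
have P3 : P ^+ 3 = 0.
  by apply/eqP; rewrite -natrX (Zp_nat_eq0 _ Hp) dvdnn.
have PA : A ^+ 4 = P - 1 by rewrite /P /p natrD natrX addrK.
have AB : A * B = 1.
  have -> : A * B = 1 - P ^+ 3 + (P - 1 - A ^+ 4) * (1 + P + P ^+ 2).
    by rewrite /B; ring.
  by rewrite P3 PA; ring.
have De : delta A B = - B ^+ 2 * P.
  have -> : P = A ^+ 4 + 1 by rewrite PA; ring.
  by rewrite /delta; ring: AB.
have D3 : delta A B ^+ 3 = 0 by rewrite De exprMn P3 mulr0.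
have N0 : bracket_norm A B D = 0.
  have [r Hr] := @bracket_dvd R A B _ _ Hk.
  have [s Hs] := @bracket_dvd R B A _ _ Hk.
  rewrite /bracket_norm Hr Hs -(deltaC A B).
  by rewrite -[RHS](mul0r (delta A B * r * s)) -D3; ring.
have [r Hr] := conway_norm_delta m n AB.
have : P ^+ 2 * t%:R ^+ 2 = 0.
  have <- : A ^+ 4 * delta A B ^+ 2 = P ^+ 2 by rewrite De; ring: AB.
  have : A ^+ 4 * bracket_norm A B (conway [:: m; 2; n]) = 0.
    by rewrite -(bracket_norm_equiv AB HD) N0 mulr0.
  rewrite Hr -/t => E; rewrite -[RHS]E.
  have -> : A ^+ 4 * (delta A B ^+ 2 * (t%:R ^+ 2 + delta A B * r)) =
    A ^+ 4 * delta A B ^+ 2 * t%:R ^+ 2 + A ^+ 4 * r * delta A B ^+ 3 by ring.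
  by rewrite D3; ring.
move=> /eqP; rewrite -!natrX -natrM (Zp_nat_eq0 _ Hp).
rewrite expnSr dvdn_pmul2l; last by rewrite expn_gt0 /p addn1.
move/dvdn_leq; rewrite expn_gt0 Ht => /(_ isT).
rewrite leqNgt => /negP; apply.
by have : (t ^ 2 <= t ^ 4)%N; [rewrite leq_pexp2l | rewrite /p; lia].
Qed.

(** * The span of the bracket *)

(** Where two states agree, their weights cancel in [bracket_norm]; where they
    differ, the product is [A ^+ 2] or [B ^+ 2]. *)
Lemma weight_pair_integral (cs s t : seq bool) :
    size s = size cs -> size t = size cs ->
  2 ^+ (2 * differences s t) *
    (weight (2 : rat) 2^-1 cs s * weight (2^-1 : rat) 2 cs t)
    \is a Num.int.
Proof.
elim: cs s t => [|c cs IH] [|a s] [|b t] //=.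
  by move=> _ _; rewrite /weight !big_nil.
move=> [Hs] [Ht]; have := IH _ _ Hs Ht.
rewrite /weight /differences /= !big_cons /= mulnDr exprD.
move: (\prod_(p <- _) _) (\prod_(p <- _) _) (_ ^+ (2 * count _ _)) => y x z Hz.
suff [k ->] : exists k : nat,
    2 ^+ (2 * (a != b)) * z * ((if c == a then 2 else 2^-1) * x *
      ((if c == b then 2^-1 else 2) * y)) = k%:R * (z * (x * y)).
  by apply: rpredM => //; apply: rpred_nat.
by case: c a b => [] [] [] /=; [exists 1%N | exists 16%N | exists 1%N
  | exists 1%N | exists 1%N | exists 1%N | exists 16%N | exists 1%N]; field.
Qed.

(** The 2-adic form of the bound on the span: at [A = 2] the pole of [bracket_norm]
    measures the difference between the extreme degrees of the bracket, and
    [loops_pair] bounds the pole of each term. *)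
Lemma norm_integral (D : diagram) : (loops (plug Fused D [::]) <= 1)%N ->
  2 ^+ (4 * crossings D + 4) * bracket_norm (2 : rat) 2^-1 D \is a Num.int.
Proof.
move=> Hk; rewrite /crossings -/(ncross D) /bracket_norm /bracket.
rewrite big_distrl big_distrr /= big_seq; apply: rpred_sum => s Hs.
rewrite big_distrr big_distrr /= big_seq; apply: rpred_sum => t Ht.
have := loops_pair (eqP (wordP D)) (size_bits Hs) (size_bits Ht).
have Hw := @weight_pair_integral (signs D) s t _ _.
rewrite !size_signs (size_bits Hs) (size_bits Ht) in Hw.
move: (loops (state D s)) (loops (state D t)) => k l Hkl.
have Hd (A B : rat) n : A * B = 1 -> A ^+ 2 + B ^+ 2 = 17 / 4 ->
    2 ^+ (2 * n) * delta A B ^+ n \is a Num.int.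
  move=> AB AB2; rewrite exprM -exprMn rpredX //.
  have -> : 2 ^+ 2 * delta A B = - 17%:R by rewrite /delta -opprD AB2; field.
  by rewrite rpredN rpred_nat.
have H2 := Hd (2 : rat) 2^-1 k erefl erefl.
have H3 := Hd (2^-1 : rat) 2 l erefl erefl.
have := rpredM (Hw erefl erefl) (rpredM H2 H3).
pose e := (4 * ncross D + 4 - (2 * differences s t + 2 * k + 2 * l))%N.
have -> : (4 * ncross D + 4 = 2 * differences s t + 2 * k + 2 * l + e)%N.
  by rewrite /e subnKC //; lia.
move: (weight _ _ _ _) (weight _ _ _ _) (delta _ _ ^+ k) (delta _ _ ^+ l).
move=> y x z u H.
have -> : 2 ^+ (2 * differences s t + 2 * k + 2 * l + e) * (x * z * (y * u)) =
  (2 ^ e)%:R * (2 ^+ (2 * differences s t) * (x * y) *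
    (2 ^+ (2 * k) * z * (2 ^+ (2 * l) * u))) :> rat.
  by rewrite !exprD natrX; ring.
by apply: rpredM => //; apply: rpred_nat.
Qed.

Definition odd_integer (x : rat) : Prop := exists k : int, x = (2 * k + 1)%:~R.

Lemma twistS (R : comNzRingType) (a b : R) n :
  twist a b n.+1 = a * twist a b n + b * (- b ^+ 3) ^+ n.
Proof. by []. Qed.

(** As a polynomial, [twist A B n.+1] has lowest term plus or minus
    [A ^- (3 * n + 1)]; the value of this term at 2 decides the 2-adic valuation. *)
Lemma twist_odd n : odd_integer (2 ^+ (3 * n + 1) * twist (2 : rat) 2^-1 n.+1).
Proof.
elim: n => [|n [k Hk]].
  by exists 0; rewrite /=; field.
have -> : 2 ^+ (3 * n.+1 + 1) * twist (2 : rat) 2^-1 n.+2 =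
    16 * (2 ^+ (3 * n + 1) * twist (2 : rat) 2^-1 n.+1) + (-1) ^+ n.+1.
  rewrite (twistS _ _ n.+1) mulrDr; congr (_ + _).
    by rewrite mulnS !exprD; move: (2 ^+ n) (twist _ _ _) => x y; ring.
  have -> : (- (2^-1 : rat) ^+ 3) ^+ n.+1 = (-1) ^+ n.+1 * (2 ^+ (3 * n.+1))^-1.
    by rewrite exprM -exprVn -exprMn; congr (_ ^+ _); field.
  by rewrite exprD; field; rewrite expf_eq0 andbF.
rewrite Hk -signr_odd; case: odd; first by exists (16 * k + 7); ring.
by exists (16 * k + 8); ring.
Qed.

Lemma twist_even n : exists k : int, 2 ^+ n * twist (2^-1 : rat) 2 n = (4 * k)%:~R.
Proof.
elim: n => [|n [k Hk]]; first by exists 0; rewrite /= mulr0.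
exists (k + (-16) ^+ n).
rewrite twistS mulrDr.
have -> : 2 ^+ n.+1 * (2^-1 * twist (2^-1 : rat) 2 n) = 2 ^+ n * twist (2^-1 : rat) 2 n.
  by rewrite exprS; field.
have -> : 2 ^+ n.+1 * (2 * (- 2 ^+ 3) ^+ n) = 4 * (-16) ^+ n :> rat.
  have -> : (-16 : rat) = 2 * (- 2 ^+ 3) by ring.
  by rewrite exprMn exprS; ring.
by rewrite Hk mulrDr !rmorphD !rmorphM /= rmorphXn.
Qed.

(** The lowest term of [conway_factor] has degree -3 times the number of crossings
    in the outer twist regions and coefficient plus or minus 1. *)
Lemma conway_factor_min m n :
  odd_integer (2 ^+ (3 * (m.+1 + n.+1)) * conway_factor (2 : rat) 2^-1 m.+1 n.+1).
Proof.
have [a Ha] := twist_odd m; have [b Hb] := twist_odd n.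
pose u : int := 2 ^+ m; pose v : int := 2 ^+ n.
exists (- 257 * (2 * a * b + a + b) - 129
  - 17 * 2048 * u ^+ 4 * v ^+ 4
  + 2048 * ((2 * a + 1) * v ^+ 4 + u ^+ 4 * (2 * b + 1))).
have Hu : u%:~R = 2 ^+ m :> rat by rewrite rmorphXn.
have Hv : v%:~R = 2 ^+ n :> rat by rewrite rmorphXn.
have u0 : 2 ^+ m != 0 :> rat by rewrite expf_eq0 andbF.
have v0 : 2 ^+ n != 0 :> rat by rewrite expf_eq0 andbF.
rewrite /conway_factor.
have -> : twist (2 : rat) 2^-1 m.+1 = (2 * a + 1)%:~R / (2 * (2 ^+ m) ^+ 3).
  by rewrite -Ha addn1 exprS mulnC exprM; field.
have -> : twist (2 : rat) 2^-1 n.+1 = (2 * b + 1)%:~R / (2 * (2 ^+ n) ^+ 3).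
  by rewrite -Hb addn1 exprS mulnC exprM; field.
have -> : 2 ^+ (3 * (m.+1 + n.+1)) = 64 * (2 ^+ m) ^+ 3 * (2 ^+ n) ^+ 3 :> rat.
  by rewrite mulnC exprM exprD !exprS; ring.
have -> : (2 * (- 257 * (2 * a * b + a + b) - 129
  - 17 * 2048 * u ^+ 4 * v ^+ 4
  + 2048 * ((2 * a + 1) * v ^+ 4 + u ^+ 4 * (2 * b + 1))) + 1)%:~R
  = - 257 * (2 * a + 1)%:~R * (2 * b + 1)%:~R
  - 17 * 4096 * u%:~R ^+ 4 * v%:~R ^+ 4
  + 4096 * ((2 * a + 1)%:~R * v%:~R ^+ 4 + u%:~R ^+ 4 * (2 * b + 1)%:~R) :> rat.
  by ring.
rewrite Hu Hv; clear Ha Hb Hu Hv u v.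
rewrite /delta !(exprS 2 m) !(exprS 2 n).
move: (2 ^+ m) (2 ^+ n) u0 v0 (_ %:~R) (_ %:~R) => u v u0 v0 x y.
by field; rewrite u0 v0.
Qed.

(** The value at [A = 1 / 2] detects the highest term instead, which has coefficient
    -1 and degree [m + n + 8]. *)
Lemma conway_factor_max m n :
  odd_integer (2 ^+ (m + n + 8) * conway_factor (2^-1 : rat) 2 m n).
Proof.
have [a Ha] := twist_even m; have [b Hb] := twist_even n.
exists (-9 + 8 * (a + b) - 257 * 128 * a * b).
have u0 : 2 ^+ m != 0 :> rat by rewrite expf_eq0 andbF.
have v0 : 2 ^+ n != 0 :> rat by rewrite expf_eq0 andbF.
have -> : (2 * (- 9 + 8 * (a + b) - 257 * 128 * a * b) + 1)%:~R =
  - 17 + 4 * ((4 * a)%:~R + (4 * b)%:~R) - 257 * 16 * (4 * a)%:~R * (4 * b)%:~R :> rat.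
  by ring.
rewrite -Ha -Hb /conway_factor /delta !exprD !exprVn.
move: (twist _ _ m) (twist _ _ n) => x y.
move: (2 ^+ m) (2 ^+ n) u0 v0 => u v u0 v0.
by field; rewrite u0 v0.
Qed.

End Specializations.

Section Minimality.
Local Open Scope ring_scope.

Lemma crossings_conway m n : crossings (conway [:: m; 2; n]) = (m + 2 + n)%N.
Proof.
by rewrite /crossings /= cats0 !count_cat /= ?count_cat /= !count_nseq /is_cross /=; lia.
Qed.

Lemma odd_integerM x y : odd_integer x -> odd_integer y -> odd_integer (x * y).
Proof. by move=> [a ->] [b ->]; exists (2 * a * b + a + b); ring. Qed.

(** For this diagram the bound of [norm_integral] is attained. *)
Lemma conway_norm_odd m n : odd_integer
  (2 ^+ (4 * crossings (conway [:: m.+1; 2; n.+1]) + 4) *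
   bracket_norm (2 : rat) 2^-1 (conway [:: m.+1; 2; n.+1])).
Proof.
rewrite crossings_conway /bracket_norm !bracket_conway //.
have -> : (4 * (m.+1 + 2 + n.+1) + 4 =
  3 * (m.+1 + n.+1) + (m.+1 + n.+1 + 8) + 4)%N by lia.
have := odd_integerM (conway_factor_min m n) (conway_factor_max m.+1 n.+1).
set a := (3 * _)%N; set b := (_ + 8)%N => H.
have : odd_integer 289 by exists 144.
move=> /odd_integerM /(_ H); congr odd_integer.
rewrite [2 ^+ (a + b + 4)]exprD [2 ^+ (a + b)]exprD /delta.
move: (conway_factor _ _ _ _) (conway_factor _ _ _ _) (2 ^+ a) (2 ^+ b).
by move=> x y u v; field.
Qed.

Lemma odd_integer_not_even (x : rat) : odd_integer x ->
  (x / 2) \isn't a Num.int.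
Proof.
case=> k ->; apply/negP => /intrP[z] /(congr1 (fun y => y * 2)).
rewrite divfK // => E.
have : (2 * k + 1)%:~R = (z * 2)%:~R :> rat by rewrite E; ring.
by move/intr_inj; lia.
Qed.

(** Fewer crossings would make the pole of [bracket_norm] too small. *)
Theorem conway_minimal D m n : (0 < m)%N -> (0 < n)%N ->
  link_equiv D (conway [:: m; 2; n]) ->
  (crossings (conway [:: m; 2; n]) <= crossings D)%N.
Proof.
move=> Hm Hn HD; have Hk := norm_integral (conway_connected Hm HD).
case: m n Hm Hn HD => // m [|n] // _ _ HD.
have AB : (2 : rat) * 2^-1 = 1 by [].
rewrite (bracket_norm_equiv AB HD) in Hk.
rewrite leqNgt; apply/negP => Hlt.
have /negP := odd_integer_not_even (conway_norm_odd m n); apply.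
move: Hlt Hk; set c := crossings (conway _); set c' := crossings _ => Hlt Hk.
have -> : (4 * c + 4 = (4 * c' + 4) + (4 * (c - c')).-1.+1)%N by lia.
rewrite exprD exprSr.
have -> : 2 ^+ (4 * c' + 4) * (2 ^+ (4 * (c - c')).-1 * 2) *
    bracket_norm (2 : rat) 2^-1 (conway [:: m.+1; 2; n.+1]) / 2 =
  (2 ^ (4 * (c - c')).-1)%:R * (2 ^+ (4 * c' + 4) *
    bracket_norm (2 : rat) 2^-1 (conway [:: m.+1; 2; n.+1])).
  by rewrite natrX; move: (2 ^+ _) (2 ^+ _) (bracket_norm _ _ _) => x y z; field.
by apply: rpredM => //; apply: rpred_nat.
Qed.

End Minimality.

(** * Unknotting after the region crossing change *)

Lemma diagram_eq (D D' : diagram) : word D = word D' -> D = D'.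
Proof.
case: D D' => [w Hw] [w' Hw'] /= E; rewrite -E in Hw' *.
by rewrite (bool_irrelevance Hw Hw').
Qed.

Definition word_trivial (w : seq letter) : Prop :=
  exists D : diagram, word D = w /\ trivial_diagram D.

Lemma word_trivial_move u a b v : move a b \/ move b a ->
  Defs.closed (u ++ a ++ v) -> word_trivial (u ++ b ++ v) ->
  word_trivial (u ++ a ++ v).
Proof.
move=> Hab Ha [D [ED [k Hk]]]; exists (Diagram Ha); split=> //; exists k.
apply: rst_trans Hk; case: Hab => Hab; [|apply: rst_sym]; apply: rst_step.
  by exists u, v, a, b; rewrite ED.
by exists u, v, b, a; rewrite ED.
Qed.

Lemma unlink_trivial k : word_trivial (unlink_word k).
Proof. by exists (unlink k); split=> //; exists k; apply: rst_refl. Qed.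

Lemma plat_closed (a b : nat) :
  Defs.closed (plat (nseq a (Cross false, 1) ++ nseq b (Cross true, 1))).
Proof.
rewrite /Defs.closed /plat /= -catA.
have E s n w : strands 4 (nseq n (Cross s, 1) ++ w) = strands 4 w.
  by elim: n.
by rewrite !E.
Qed.

(** Opposite crossings of the middle strands cancel in pairs, and a single one left
    over is a curl. *)
Lemma plat_trivial a b : a <= b.+1 -> b <= a.+1 ->
  word_trivial (plat (nseq a (Cross false, 1) ++ nseq b (Cross true, 1))).
Proof.
have zero : word_trivial [:: (Cup, 0); (Cup, 2); (Cap, 0); (Cap, 0)].
  apply: (@word_trivial_move [:: (Cup, 0)] _ _ [:: (Cap, 0)]
    (or_intror (Exchange Cap Cup 0 0))) => //.
  exact: (unlink_trivial 2).
have one s : word_trivial [:: (Cup, 0); (Cup, 2); (Cross s, 1); (Cap, 0); (Cap, 0)].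
  rewrite -(negbK s).
  apply: (@word_trivial_move [:: (Cup, 0)] _ _ [:: (Cap, 0); (Cap, 0)]
    (or_intror (SwingCup (~~ s) 1))) => //.
  apply: (@word_trivial_move [:: (Cup, 0); (Cup, 1)] _ _ [:: (Cap, 0)]
    (or_intror (Exchange Cap (Cross (~~ s)) 0 0))) => //.
  apply: (@word_trivial_move [:: (Cup, 0); (Cup, 1); (Cap, 0)] _ _ [::]
    (or_introl (Reidemeister1Cap (~~ s) 0))) => //.
  apply: (@word_trivial_move [:: (Cup, 0)] _ _ [:: (Cap, 0)]
    (or_introl (ZigzagR 0))) => //.
  exact: (unlink_trivial 1).
elim: a b => [|a IH] [|b] Ha Hb //; rewrite ?cats0.
- by case: b Ha Hb => [|b] // _ _; apply: one.
- by case: a Ha Hb {IH} => [|a] // _ _; apply: one.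
have E : plat (nseq a.+1 (Cross false, 1) ++ nseq b.+1 (Cross true, 1)) =
  ([:: (Cup, 0); (Cup, 2)] ++ nseq a (Cross false, 1)) ++
  [:: (Cross false, 1); (Cross true, 1)] ++
  (nseq b (Cross true, 1) ++ [:: (Cap, 0); (Cap, 0)]).
  have -> : nseq a.+1 (Cross false, 1) = nseq a (Cross false, 1) ++ [:: (Cross false, 1)].
    by elim: (a) => //= k ->.
  by rewrite /plat -!catA.
have := plat_closed a.+1 b.+1; rewrite E => Hc.
apply: word_trivial_move (or_introl (Reidemeister2 false 1)) Hc _.
by rewrite cat0s -catA; have := IH b Ha Hb; rewrite /plat -!catA.
Qed.

(** * The region *)

(** The diagram of C(m, 2, n) and the result of the region crossing change differ
    only in the letters [x], [y], [z]. *)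
Definition two_twists (m n : nat) (x y z : letter) : seq letter :=
  [:: (Cup, 0); (Cup, 2)] ++ nseq m x ++ [:: y; z]
  ++ nseq n (Cross true, 1) ++ [:: (Cap, 0); (Cap, 0)].

Lemma conway_word_two_twists m n : conway_word [:: m; 2; n] =
  two_twists m n (Cross true, 1) (Cross false, 0) (Cross false, 0).
Proof. by rewrite /conway_word /two_twists /= cats0 -!catA. Qed.

Lemma nth_two_twists m n x y z t : nth (Cup, 0) (two_twists m n x y z) t =
  if t == 0 then (Cup, 0) else if t == 1 then (Cup, 2) else
  if t < m + 2 then x else if t == m + 2 then y else if t == m + 3 then z else
  if t < m + 4 + n then (Cross true, 1) else
  nth (Cup, 0) [:: (Cap, 0); (Cap, 0)] (t - (m + 4 + n)).
Proof.
case: t => [|[|t]] //; rewrite /two_twists /= !nth_cat !size_nseq !nth_nseq.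
have [Hm|Hm] := ltnP t m.
  by rewrite !ifT //; lia.
rewrite ifF; last by lia.
case: (t - m) (subnKC Hm) => [|[|k]] /= <-.
- by rewrite ifT //; lia.
- by rewrite ifF ?ifT //; lia.
rewrite 2?ifF; try lia.
have -> : ((m + k.+2).+2 < m + 4 + n) = (k < n) by lia.
by rewrite nth_cat size_nseq nth_nseq; case: ltnP => // Hn; congr (nth _ _ _); lia.
Qed.

Section Region.
Variables m n : nat.
Let D := conway [:: m; 2; n].

Lemma letter_conway t : letter_at D t =
  if t == 0 then (Cup, 0) else if t == 1 then (Cup, 2) else
  if t < m + 2 then (Cross true, 1) else
  if (t == m + 2) || (t == m + 3) then (Cross false, 0) else
  if t < m + 4 + n then (Cross true, 1) else
  nth (Cup, 0) [:: (Cap, 0); (Cap, 0)] (t - (m + 4 + n)).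
Proof.
rewrite /letter_at /D /= conway_word_two_twists nth_two_twists.
by do 4 case: ifP => //=.
Qed.

Lemma size_conway : size D = m + n + 6.
Proof.
rewrite -[size D]/(size (conway_word _)) conway_word_two_twists /two_twists.
by rewrite !size_cat !size_nseq /=; lia.
Qed.

Lemma width_conway t : 0 < t <= m + 2 -> 0 < width D t.
Proof.
case: t => [|[|t]] // Ht.
rewrite /width -[word D]/(conway_word _) conway_word_two_twists /= take_cat size_nseq.
case: (ltnP t m) => Hm.
  rewrite take_nseq; last exact: ltnW.
  by have -> : strands 4 (nseq t (Cross true, 1)) = Some 4 by elim: (t).
have -> : t - m = 0 by lia.
by rewrite take0 cats0; have -> : strands 4 (nseq m (Cross true, 1)) = Some 4 by elim: (m).
Qed.

Lemma gap_exists t : 0 < t <= m + 2 ->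
  exists x : gap D, level x = t /\ offset x = 1.
Proof.
move=> Ht; have Hs : t < (size D).+1 by rewrite size_conway; lia.
have Hw : 1 < (width D (Ordinal Hs)).+1 by rewrite ltnS; apply: width_conway.
by exists (Tagged (fun t : 'I_(size D).+1 => 'I_(width D t).+1) (Ordinal Hw)).
Qed.

(** The gaps of the region between the two strands of the first cup: it reaches from
    the cup to the lower middle crossing. *)
Definition in_loop (x : gap D) : bool :=
  (0 < level x <= m + 2) && (offset x == 1).

Lemma gap_above_loop x y : gap_above x y -> in_loop x = in_loop y.
Proof.
rewrite /gap_above /in_loop letter_conway.
move: (level x) (level y) (offset x) (offset y) => s t a b.
do 5 (case: ifP => /= ?; first by lia).
case: (s - (m + 4 + n)) => [|[|k]] /=; rewrite ?nth_nil /=; lia.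
Qed.

Lemma connect_loop x y : in_loop x -> connect (@gap_adj D) x y -> in_loop y.
Proof.
move=> Hx /connectP[p Hp ->]; elim: p x Hx Hp => //= z p IH x Hx /andP[Hz].
by apply: IH; case/orP: Hz => /gap_above_loop E; rewrite -?E // E.
Qed.

Lemma gap_above_column (x y : gap D) : level y = (level x).+1 -> 0 < level x < m + 2 ->
  offset x = 1 -> offset y = 1 -> gap_above x y.
Proof.
move=> Hy Hx Ox Oy; rewrite /gap_above letter_conway Hy Ox Oy eqxx.
move: (level x) Hx => s Hs.
by do 3 (case: ifP => /= ?; first by lia); lia.
Qed.

Lemma connect_column (x : gap D) t : level x = 1 -> offset x = 1 -> 0 < t <= m + 2 ->
  exists2 y, connect (@gap_adj D) x y & level y = t /\ offset y = 1.
Proof.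
move=> Lx Ox; elim: t => // -[_ _|t IH Ht]; first by exists x.
have [|y Hy [Ly Oy]] := IH; first by lia.
have [z [Lz Oz]] := gap_exists Ht.
exists z => //; apply: connect_trans Hy _; apply: connect1.
by rewrite /gap_adj /= gap_above_column // ?Ly ?Lz //; lia.
Qed.

Lemma letter_column t : 1 < t <= m + 2 ->
  exists s i, letter_at D t = (Cross s, i) /\ i <= 1.
Proof.
case/andP; rewrite letter_conway; case: t => [|[|t]] //= _ Ht.
case: ltnP => Hm; first by exists true, 1.
by exists false, 0; rewrite ifT //; lia.
Qed.

Lemma on_boundary_column (x : gap D) t : level x = 1 -> offset x = 1 ->
  on_boundary [set y | connect (@gap_adj D) x y] t = (1 < t <= m + 2).
Proof.
move=> Lx Ox; have Hx : in_loop x by rewrite /in_loop Lx Ox; lia.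
apply/andP/idP => [[Hc /existsP[y /and3P[]]]|Ht].
  rewrite inE => /(connect_loop Hx) /andP[Hy _] Hl _.
  case: t Hc Hl => [|[|t]] /=; rewrite ?letter_conway //=; lia.
have [s [i [El Hi]]] := letter_column Ht; rewrite El; split=> //.
have [|y Hy [Ly Oy]] := @connect_column x t Lx Ox; first by lia.
apply/existsP; exists y; rewrite inE Hy Ly Oy /=; lia.
Qed.

(** The region meets the lower twist region along all its crossings, but only one of
    the two middle crossings. *)
Lemma region_change_column (x : gap D) : level x = 1 -> offset x = 1 ->
  region_change_word [set y | connect (@gap_adj D) x y] =
  two_twists m n (Cross false, 1) (Cross true, 0) (Cross false, 0).
Proof.
move=> Lx Ox; apply: (@eq_from_nth _ (Cup, 0)).
  rewrite size_mkseq size_conway /two_twists !size_cat !size_nseq /=; lia.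
rewrite size_mkseq => t Ht; rewrite nth_mkseq // on_boundary_column //.
rewrite letter_conway nth_two_twists.
case: t Ht => [|[|t]] Ht //=.
case: (ltnP t.+2 (m + 2)) => H1 /=; first by rewrite (ltnW H1).
case: (eqVneq t.+2 (m + 2)) => H2 /=; first by rewrite H2 leqnn.
rewrite ifF //; lia.
Qed.

End Region.

(** A trivial link has a diagram without crossings, contrary to
    [conway_minimal]. *)
Lemma not_trivial m n : 0 < m -> 0 < n -> forall D,
  link_equiv D (conway [:: m; 2; n]) -> ~ trivial_diagram D.
Proof.
move=> Hm Hn D HD [k Hk].
have := conway_minimal Hm Hn (rst_trans _ _ _ _ _ (rst_sym _ _ _ _ Hk) HD).
rewrite crossings_conway.
have -> : crossings (unlink k) = 0 by rewrite /crossings /=; elim: k {Hk}.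
by lia.
Qed.

Lemma region_changes0 D D' : region_changes 0 D D' -> D' = D.
Proof. by move E: 0 => k H; case: H E. Qed.

(** The middle crossings now cancel, which joins two twist regions of opposite
    signs. *)
Lemma two_twists_trivial m n : m <= n.+1 -> n <= m.+1 ->
  word_trivial (two_twists m n (Cross false, 1) (Cross true, 0) (Cross false, 0)).
Proof.
move=> Hm Hn; have := plat_trivial Hm Hn; rewrite /plat -!catA => H.
have E s k w : strands 4 (nseq k (Cross s, 1) ++ w) = strands 4 w.
  by elim: k.
rewrite /two_twists (catA [:: _; _]).
apply: (@word_trivial_move _ [:: (Cross true, 0); (Cross false, 0)] [::] _
  (or_introl (Reidemeister2 true 0))).
  by rewrite /Defs.closed -catA /= E /= E.
by rewrite cat0s -catA.
Qed.

Theorem conway_region_unknotting m n : 0 < m -> 0 < n ->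
  m <= n.+1 -> n <= m.+1 ->
  region_unknotting_number (conway [:: m; 2; n]) 1.
Proof.
move=> Hm Hn Hmn Hnm; pose D := conway [:: m; 2; n].
have Hnt := not_trivial Hm Hn.
have Hpos D' k : link_equiv D' D -> diagram_region_unknotting_number D' k -> 0 < k.
  case: k => // HD [[D'' [/region_changes0 ->]]].
  by move=> /(Hnt _ HD).
split; last by move=> k [D' [[HD _]]]; apply: Hpos.
exists D; split; first by split=> [|D']; [apply: rst_refl | apply: conway_minimal].
split; last first.
  case=> // [[D' [/region_changes0 ->]]] /Hnt; case; exact: rst_refl.
have [x [Lx Ox]] : exists x : gap D, level x = 1 /\ offset x = 1.
  by apply: gap_exists; lia.
have [D' [ED' HD']] := two_twists_trivial Hmn Hnm.
exists D'; split=> //.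
apply: (@ChangesS _ _ _ [set y | connect (@gap_adj D) x y]).
  by apply/imsetP; exists x.
have -> : region_change [set y | connect (@gap_adj D) x y] = D'.
  by apply: diagram_eq; rewrite ED' /= region_change_column.
exact: Changes0.
Qed.

Theorem corollary2p1 (m : nat) (hm : 0 < m) :
  [/\ region_unknotting_number (conway [:: m; 2; m]) 1,
      region_unknotting_number (conway [:: m; 2; m.+1]) 1
    & 2 <= m -> region_unknotting_number (conway [:: m; 2; m.-1]) 1].
Proof.
by split=> [||Hm2]; apply: conway_region_unknotting; lia.
Qed.
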